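(* Let $\mathcal{P}\colon \mathbb{C}\hookrightarrow\mathbb{E}$ be a projective cover of an exact category $\mathbb{E}$. Suppose that one of the following (equivalent) conditions holds: \begin{enumerate} \item[(a)] for every object $U$ in $\mathbb{C}$, projective objects in $\mathbb{E}/\mathcal{P}U$ are internally projective; \item[(b)] the full subcategory $\mathrm{P}(\mathbb{E})$ of $\mathbb{E}$ on the projective objects (which is equivalent to the splitting of idempotents $\overline{\mathbb{C}}$ of $\mathbb{C}$) has pullbacks; \item[(c)] for every weak pullback $Z\xleftarrow{p_1}V\xrightarrow{p_2}X$ of a cospan $Z\to U\leftarrow X$ in $\mathbb{C}$ there is an idempotent $i\colon V\to V$ which is determined by projections and such that $p_1i=p_1$ and $p_2i=p_2$. \end{enumerate} Then the following are equivalent: \begin{enumerate} \item $\mathbb{C}$ has weak dependent products; \item $\mathbb{C}$ has extensional dependent products; \item $\mathbb{E}$ is locally cartesian closed. \end{enumerate}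
   Context: A category is exact if it has finite limits, regular epis are stable under pullback, and every equivalence relation $(r_1,r_2)\colon R\hookrightarrow X\times X$ has a coequaliser $q$ of $r_1,r_2$ such that $r_1,r_2$ is a kernel pair of $q$. An object $P$ of a category is (regular) projective if every arrow $P\to B$ lifts along every regular epi $A\to B$. A projective cover of an exact category $\mathbb{E}$ is (the inclusion $\mathcal{P}$ of) a full subcategory $\mathcal{P}\colon\mathbb{C}\hookrightarrow\mathbb{E}$ such that $\mathcal{P}X$ is projective in $\mathbb{E}$ for every $X$ in $\mathbb{C}$, and for every $A$ in $\mathbb{E}$ there are $X$ in $\mathbb{C}$ and a regular epi $\mathcal{P}X\to A$. In this situation $\mathbb{C}$ has weak finite limits. A weak limit is defined as a limit but without requiring uniqueness of the induced arrow. An object $P$ of a category with binary products is internally (regular) projective if for every object $C$, regular epi $r\colon A\to B$ and arrow $f\colon C\times P\to B$ there are an object $T$, a regular epi $t\colon T\to C$ and an arrow $f'\colon T\times P\to A$ with $rf'=f(t\times\mathrm{id}_P)$. A pseudo equivalence relation $x_1,x_2\colon\bar X\rightrightarrows X$ in $\mathbb{C}$ consists of arrows $x_1,x_2\colon\bar X\to X$ for which there are $\rho\colon X\to\bar X$, $\sigma\colon\bar X\to\bar X$ and $\tau\colon W\to\bar X$, where $W$ with $p_1,p_2\colon W\to\bar X$ is a weak pullback of $x_2$ and $x_1$ (so $x_2p_1=x_1p_2$), with $x_1\rho=x_2\rho=\mathrm{id}_X$, $x_1\sigma=x_2$, $x_2\sigma=x_1$, $x_1\tau=x_1p_1$, $x_2\tau=x_2p_2$.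 A weak kernel pair of a span $X\xleftarrow{p_1}V\xrightarrow{p_2}W$ is a pair $v_1,v_2\colon\bar V\to V$ with $p_iv_1=p_iv_2$ for $i=1,2$, weakly universal with this property. Let $X\xleftarrow{p_1}V\xrightarrow{p_2}W$ be a weak pullback of a cospan. An arrow $f\colon V\to Y$ preserves (pullback) projections with respect to a pseudo equivalence relation $y_1,y_2\colon\bar Y\rightrightarrows Y$ if, for a weak kernel pair $v_1,v_2\colon\bar V\to V$ of $p_1,p_2$, there is $\bar f\colon\bar V\to\bar Y$ with $y_i\bar f=fv_i$ for $i=1,2$. It is determined by projections if, for all parallel arrows $h,k$ into $V$, $p_1h=p_1k$ and $p_2h=p_2k$ imply $fh=fk$ (equivalently, it preserves projections with respect to $\mathrm{id}_Y,\mathrm{id}_Y$). Extensional dependent product: let $y_1,y_2\colon\bar Y\rightrightarrows Y$ be a pseudo equivalence relation and $Y\xrightarrow{g}X\xrightarrow{f}Z$ arrows with $gy_1=gy_2$. Consider data $D=(W,w,V,p_1,p_2,e)$ where $w\colon W\to Z$, $X\xleftarrow{p_1}V\xrightarrow{p_2}W$ is a weak pullback of $f$ and $w$, and $e\colon V\to Y$ preserves projections with respect to $y_1,y_2$ and satisfies $ge=p_1$. An extensional dependent product of $g$ along $f$ with respect to $y_1,y_2$ is such a $D$ with the property that for every other such $D'=(W',w',V',p_1',p_2',e')$ there are $h\colon W'\to W$ and $k\colon V'\to V$ with $wh=w'$, $p_1k=p_1'$, $p_2k=hp_2'$, $ek=e'$. $\mathbb{C}$ has extensional dependent products if one exists for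 all such $y_1,y_2$ and $g,f$. A weak dependent product of $g$ along $f$ is an extensional dependent product with respect to $\mathrm{id}_Y,\mathrm{id}_Y$; $\mathbb{C}$ has weak dependent products if one exists for every composable pair $Y\xrightarrow{g}X\xrightarrow{f}Z$. *)

(* Defs.v *)
From Stdlib Require Import List ProofIrrelevance.
From Stdlib Require Import FinFun.

Set Implicit Arguments.
Unset Strict Implicit.
Unset Printing Implicit Defensive.

(** * Categories, functors, slices, full subcategories *)

Record Category : Type := {
  Ob : Type;
  Hom : Ob -> Ob -> Type;
  idm : forall A : Ob, Hom A A;
  comp : forall A B C : Ob, Hom B C -> Hom A B -> Hom A C;
  comp_idl : forall (A B : Ob) (f : Hom A B), comp (idm B) f = f;
  comp_idr : forall (A B : Ob) (f : Hom A B), comp f (idm A) = f;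
  comp_assoc : forall (A B C D : Ob)
      (h : Hom C D) (g : Hom B C) (f : Hom A B),
    comp h (comp g f) = comp (comp h g) f
}.

Arguments Hom {_} _ _.
Arguments idm {_} _.
Arguments comp {_ _ _ _} _ _.

Declare Scope cat_scope.
Delimit Scope cat_scope with cat.
Open Scope cat_scope.
Notation "g ∘ f" := (comp g f) (at level 40, left associativity) : cat_scope.

Record Functor (J E : Category) : Type := {
  fob :> Ob J -> Ob E;
  fmap : forall a b : Ob J, Hom a b -> Hom (fob a) (fob b);
  fmap_id : forall a : Ob J, fmap (idm a) = idm (fob a);
  fmap_comp : forall (a b c : Ob J) (g : Hom b c) (f : Hom a b),
    fmap (g ∘ f) = fmap g ∘ fmap f
}.

Record SliceOb (E : Category) (A : Ob E) : Type := {
  slice_dom : Ob E;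
  slice_map : Hom slice_dom A
}.

Definition SliceHom (E : Category) (A : Ob E) (x y : SliceOb A) : Type :=
  {h : Hom (slice_dom x) (slice_dom y) | slice_map y ∘ h = slice_map x}.

Lemma SliceHom_eq (E : Category) (A : Ob E) (x y : SliceOb A)
    (h k : SliceHom x y) : proj1_sig h = proj1_sig k -> h = k.
Proof.
destruct h as [h hE], k as [k kE]; simpl; intros e; subst k.
f_equal; apply proof_irrelevance.
Qed.

Definition slice_id (E : Category) (A : Ob E) (x : SliceOb A) : SliceHom x x :=
  exist _ (idm (slice_dom x)) (comp_idr (slice_map x)).

Lemma slice_comp_subproof (E : Category) (A : Ob E) (x y z : SliceOb A)
    (g : SliceHom y z) (f : SliceHom x y) :
  slice_map z ∘ (proj1_sig g ∘ proj1_sig f) = slice_map x.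
Proof. now rewrite comp_assoc, (proj2_sig g), (proj2_sig f). Qed.

Definition slice_comp (E : Category) (A : Ob E) (x y z : SliceOb A)
    (g : SliceHom y z) (f : SliceHom x y) : SliceHom x z :=
  exist _ (proj1_sig g ∘ proj1_sig f) (slice_comp_subproof g f).

Definition Slice (E : Category) (A : Ob E) : Category.
Proof.
refine {| Ob := SliceOb A; Hom := @SliceHom E A;
          idm := @slice_id E A; comp := @slice_comp E A |};
  intros; apply SliceHom_eq; simpl.
- apply comp_idl.
- apply comp_idr.
- apply comp_assoc.
Defined.

Definition FullSub (E : Category) (S : Ob E -> Prop) : Category := {|
  Ob := {X : Ob E | S X};
  Hom := fun X Y => Hom (proj1_sig X) (proj1_sig Y);
  idm := fun X => idm (proj1_sig X);
  comp := fun X Y Z g f => g ∘ f;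
  comp_idl := fun X Y f => comp_idl f;
  comp_idr := fun X Y f => comp_idr f;
  comp_assoc := fun X Y Z W h g f => comp_assoc h g f
|}.

Definition incl (E : Category) (S : Ob E -> Prop) : Functor (FullSub S) E := {|
  fob := fun X : Ob (FullSub S) => proj1_sig X;
  fmap := fun (X Y : Ob (FullSub S)) (f : Hom X Y) => f;
  fmap_id := fun X => eq_refl;
  fmap_comp := fun X Y Z g f => eq_refl
|}.

Arguments incl {E} S.

(** * Limits and weak limits *)

Section Limits.

Variable E : Category.

Definition IsLimit (J : Category) (D : Functor J E) (L : Ob E)
    (pi : forall j : Ob J, Hom L (D j)) : Prop :=
  (forall (j k : Ob J) (a : Hom j k), fmap D a ∘ pi j = pi k) /\
  (forall (T : Ob E) (c : forall j : Ob J, Hom T (D j)),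
     (forall (j k : Ob J) (a : Hom j k), fmap D a ∘ c j = c k) ->
     exists! u : Hom T L, forall j : Ob J, pi j ∘ u = c j).

Definition IsFiniteCategory (J : Category) : Prop :=
  Finite (Ob J) /\ forall a b : Ob J, Finite (Hom a b).

Definition HasFiniteLimits : Prop :=
  forall (J : Category) (D : Functor J E), IsFiniteCategory J ->
  exists (L : Ob E) (pi : forall j : Ob J, Hom L (D j)), IsLimit pi.

Definition IsTerminal (A : Ob E) : Prop :=
  forall T : Ob E, exists! u : Hom T A, True.

Definition IsProduct (A B Q : Ob E) (p1 : Hom Q A) (p2 : Hom Q B) : Prop :=
  forall (T : Ob E) (a : Hom T A) (b : Hom T B),
  exists! u : Hom T Q, p1 ∘ u = a /\ p2 ∘ u = b.

Definition IsPullback (A B C V : Ob E) (f : Hom A C) (g : Hom B C)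
    (p1 : Hom V A) (p2 : Hom V B) : Prop :=
  f ∘ p1 = g ∘ p2 /\
  forall (T : Ob E) (a : Hom T A) (b : Hom T B), f ∘ a = g ∘ b ->
  exists! u : Hom T V, p1 ∘ u = a /\ p2 ∘ u = b.

Definition IsWeakPullback (A B C V : Ob E) (f : Hom A C) (g : Hom B C)
    (p1 : Hom V A) (p2 : Hom V B) : Prop :=
  f ∘ p1 = g ∘ p2 /\
  forall (T : Ob E) (a : Hom T A) (b : Hom T B), f ∘ a = g ∘ b ->
  exists u : Hom T V, p1 ∘ u = a /\ p2 ∘ u = b.

Definition IsKernelPair (X Y R : Ob E) (q : Hom X Y) (r1 r2 : Hom R X) : Prop :=
  IsPullback q q r1 r2.

Definition IsWeakKernelPair (X V W K : Ob E) (p1 : Hom V X) (p2 : Hom V W)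
    (v1 v2 : Hom K V) : Prop :=
  p1 ∘ v1 = p1 ∘ v2 /\ p2 ∘ v1 = p2 ∘ v2 /\
  forall (T : Ob E) (a b : Hom T V),
    p1 ∘ a = p1 ∘ b -> p2 ∘ a = p2 ∘ b ->
    exists u : Hom T K, v1 ∘ u = a /\ v2 ∘ u = b.

Definition HasTerminal : Prop := exists A : Ob E, IsTerminal A.

Definition HasBinaryProducts : Prop :=
  forall A B : Ob E, exists (Q : Ob E) (p1 : Hom Q A) (p2 : Hom Q B),
    IsProduct p1 p2.

Definition HasPullbacks : Prop :=
  forall (A B C : Ob E) (f : Hom A C) (g : Hom B C),
  exists (V : Ob E) (p1 : Hom V A) (p2 : Hom V B), IsPullback f g p1 p2.

(** [m] is [t × id_P], for product cones [(q1, q2)] on [T, P] and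
    [(p1, p2)] on [C, P]. *)
Definition IsTimesId (T C P TP CP : Ob E) (q1 : Hom TP T) (q2 : Hom TP P)
    (p1 : Hom CP C) (p2 : Hom CP P) (t : Hom T C) (m : Hom TP CP) : Prop :=
  p1 ∘ m = t ∘ q1 /\ p2 ∘ m = q2.

(** * Regular epis and exactness *)

Definition IsMono (A B : Ob E) (m : Hom A B) : Prop :=
  forall (T : Ob E) (a b : Hom T A), m ∘ a = m ∘ b -> a = b.

Definition IsCoequaliser (R X Q : Ob E) (r1 r2 : Hom R X) (q : Hom X Q) : Prop :=
  q ∘ r1 = q ∘ r2 /\
  forall (T : Ob E) (h : Hom X T), h ∘ r1 = h ∘ r2 ->
  exists! u : Hom Q T, u ∘ q = h.

Definition IsRegularEpi (A B : Ob E) (q : Hom A B) : Prop :=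
  exists (R : Ob E) (r1 r2 : Hom R A), IsCoequaliser r1 r2 q.

Definition RegularEpisStable : Prop :=
  forall (A B C V : Ob E) (f : Hom A C) (g : Hom B C)
      (p1 : Hom V A) (p2 : Hom V B),
    IsPullback f g p1 p2 -> IsRegularEpi f -> IsRegularEpi p2.

Definition IsPseudoEquivalence (Xb X : Ob E) (x1 x2 : Hom Xb X) : Prop :=
  exists (rho : Hom X Xb) (sigma : Hom Xb Xb)
      (W : Ob E) (p1 p2 : Hom W Xb) (tau : Hom W Xb),
    IsWeakPullback x2 x1 p1 p2 /\
    x1 ∘ rho = idm X /\ x2 ∘ rho = idm X /\
    x1 ∘ sigma = x2 /\ x2 ∘ sigma = x1 /\
    x1 ∘ tau = x1 ∘ p1 /\ x2 ∘ tau = x2 ∘ p2.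

Definition IsEquivalenceRelation (R X : Ob E) (r1 r2 : Hom R X) : Prop :=
  (exists (XX : Ob E) (pi1 pi2 : Hom XX X) (m : Hom R XX),
     IsProduct pi1 pi2 /\ IsMono m /\ pi1 ∘ m = r1 /\ pi2 ∘ m = r2) /\
  (exists rho : Hom X R, r1 ∘ rho = idm X /\ r2 ∘ rho = idm X) /\
  (exists sigma : Hom R R, r1 ∘ sigma = r2 /\ r2 ∘ sigma = r1) /\
  (exists (W : Ob E) (p1 p2 tau : Hom W R),
     IsPullback r2 r1 p1 p2 /\
     r1 ∘ tau = r1 ∘ p1 /\ r2 ∘ tau = r2 ∘ p2).

Definition IsExact : Prop :=
  HasFiniteLimits /\
  RegularEpisStable /\
  forall (R X : Ob E) (r1 r2 : Hom R X), IsEquivalenceRelation r1 r2 ->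
  exists (Q : Ob E) (q : Hom X Q), IsCoequaliser r1 r2 q /\ IsKernelPair q r1 r2.

(** * Projectives *)

Definition IsProjective (P : Ob E) : Prop :=
  forall (A B : Ob E) (r : Hom A B) (f : Hom P B), IsRegularEpi r ->
  exists f' : Hom P A, r ∘ f' = f.

Definition IsInternallyProjective (P : Ob E) : Prop :=
  forall (C A B CP : Ob E) (p1 : Hom CP C) (p2 : Hom CP P)
      (r : Hom A B) (f : Hom CP B),
    IsProduct p1 p2 -> IsRegularEpi r ->
    exists (T TP : Ob E) (q1 : Hom TP T) (q2 : Hom TP P)
        (t : Hom T C) (m : Hom TP CP) (f' : Hom TP A),
      IsProduct q1 q2 /\ IsRegularEpi t /\
      IsTimesId q1 q2 p1 p2 t m /\ r ∘ f' = f ∘ m.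

(** * Cartesian closure *)

Definition IsExponential (A B X XA : Ob E) (p1 : Hom XA X) (p2 : Hom XA A)
    (ev : Hom XA B) : Prop :=
  IsProduct p1 p2 /\
  forall (T TA : Ob E) (q1 : Hom TA T) (q2 : Hom TA A) (f : Hom TA B),
    IsProduct q1 q2 ->
    exists! g : Hom T X,
      exists m : Hom TA XA, IsTimesId q1 q2 p1 p2 g m /\ ev ∘ m = f.

Definition IsCartesianClosed : Prop :=
  HasTerminal /\ HasBinaryProducts /\
  forall A B : Ob E,
  exists (X XA : Ob E) (p1 : Hom XA X) (p2 : Hom XA A) (ev : Hom XA B),
    IsExponential p1 p2 ev.

(** * Extensional and weak dependent products *)

Definition PreservesProjections (X W V : Ob E) (p1 : Hom V X) (p2 : Hom V W)
    (Yb Y : Ob E) (y1 y2 : Hom Yb Y) (f : Hom V Y) : Prop :=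
  exists (Vb : Ob E) (v1 v2 : Hom Vb V),
    IsWeakKernelPair p1 p2 v1 v2 /\
    exists fb : Hom Vb Yb, y1 ∘ fb = f ∘ v1 /\ y2 ∘ fb = f ∘ v2.

Definition DeterminedByProjections (X W V : Ob E) (p1 : Hom V X) (p2 : Hom V W)
    (Y : Ob E) (f : Hom V Y) : Prop :=
  forall (T : Ob E) (h k : Hom T V),
    p1 ∘ h = p1 ∘ k -> p2 ∘ h = p2 ∘ k -> f ∘ h = f ∘ k.

Record DepProdData (Y X Z Yb : Ob E) (g : Hom Y X) (f : Hom X Z)
    (y1 y2 : Hom Yb Y) : Type := {
  dp_W : Ob E;
  dp_w : Hom dp_W Z;
  dp_V : Ob E;
  dp_p1 : Hom dp_V X;
  dp_p2 : Hom dp_V dp_W;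
  dp_e : Hom dp_V Y;
  dp_weak_pullback : IsWeakPullback f dp_w dp_p1 dp_p2;
  dp_preserves : PreservesProjections dp_p1 dp_p2 y1 y2 dp_e;
  dp_over : g ∘ dp_e = dp_p1
}.

Definition IsExtensionalDependentProduct (Y X Z Yb : Ob E)
    (g : Hom Y X) (f : Hom X Z) (y1 y2 : Hom Yb Y)
    (D : DepProdData g f y1 y2) : Prop :=
  forall D' : DepProdData g f y1 y2,
  exists (h : Hom (dp_W D') (dp_W D)) (k : Hom (dp_V D') (dp_V D)),
    dp_w D ∘ h = dp_w D' /\
    dp_p1 D ∘ k = dp_p1 D' /\
    dp_p2 D ∘ k = h ∘ dp_p2 D' /\
    dp_e D ∘ k = dp_e D'.

Definition HasExtensionalDependentProducts : Prop :=
  forall (Y X Z Yb : Ob E) (g : Hom Y X) (f : Hom X Z) (y1 y2 : Hom Yb Y),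
    IsPseudoEquivalence y1 y2 -> g ∘ y1 = g ∘ y2 ->
    exists D : DepProdData g f y1 y2, IsExtensionalDependentProduct D.

Definition IsWeakDependentProduct (Y X Z : Ob E) (g : Hom Y X) (f : Hom X Z)
    (D : DepProdData g f (idm Y) (idm Y)) : Prop :=
  IsExtensionalDependentProduct D.

Definition HasWeakDependentProducts : Prop :=
  forall (Y X Z : Ob E) (g : Hom Y X) (f : Hom X Z),
  exists D : DepProdData g f (idm Y) (idm Y), IsWeakDependentProduct D.

(** Every weak pullback carries an idempotent over the projections which is
    determined by projections. *)
Definition WeakPullbacksHaveIdempotents : Prop :=
  forall (Z X U V : Ob E) (a : Hom Z U) (b : Hom X U)
      (p1 : Hom V Z) (p2 : Hom V X),
    IsWeakPullback a b p1 p2 ->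
    exists i : Hom V V,
      i ∘ i = i /\ DeterminedByProjections p1 p2 i /\
      p1 ∘ i = p1 /\ p2 ∘ i = p2.

End Limits.

Definition IsLocallyCartesianClosed (E : Category) : Prop :=
  forall A : Ob E, IsCartesianClosed (Slice A).

Definition IsProjectiveCover (E : Category) (S : Ob E -> Prop) : Prop :=
  (forall X : Ob (FullSub S), IsProjective (incl S X)) /\
  (forall A : Ob E, exists (X : Ob (FullSub S)) (q : Hom (incl S X) A),
     IsRegularEpi q).

Definition SliceProjectivesInternallyProjective
    (E : Category) (S : Ob E -> Prop) : Prop :=
  forall (U : Ob (FullSub S)) (P : Ob (Slice (incl S U))),
    IsProjective P -> IsInternallyProjective P.

Definition ProjectivesHavePullbacks (E : Category) : Prop :=
  HasPullbacks (FullSub (@IsProjective E)).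

(* Main.v *)
(** Each of (a), (b), (c) is equivalent to the condition that pullbacks in [E]
    of cospans in [S] are projective ([PullbacksProjective]). Since every object
    is covered by one of [S], equations, factorisations through monos and regular
    epis can all be tested on maps out of objects of [S], for which regular epis
    behave like surjections.

    From a locally cartesian closed [E], the extensional dependent product of [g]
    with respect to [y1, y2] is a cover of the dependent product in [E] of the map
    induced by [g] on the quotient of [Y]; weak dependent products are a special
    case. Conversely, let [C] have weak dependent products. Being determined by
    projections, their evaluations descend to genuine pullbacks in [E]. For
    [M -> A <- N], cover [A], [M] and [N] by objects of [S]: as fibre products
    of objects of [S] are projective, every map [T ×_A M -> N] with [T] in [S]
    lifts to the covers, so a weak dependent product gives a family of which all
    these maps are instances. Universal quantification of an equation along a map
    is the image of a weak dependent product of (a cover of) an equaliser. It cuts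
    the family down to the members that respect the cover of [M], and it gives the
    relation of extensional equality between members; the quotient of the family
    by this relation is the exponential. *)
Require Import Defs.
From Stdlib Require Import List.
Import ListNotations.

Set Implicit Arguments.
Unset Strict Implicit.
Unset Printing Implicit Defensive.

(** * Rewriting modulo associativity *)

Lemma comp_eq_assoc (E : Category) (A B C : Ob E) (f : Hom B C) (g : Hom A B)
    (h : Hom A C) : f ∘ g = h ->
  forall (T : Ob E) (x : Hom T A), f ∘ (g ∘ x) = h ∘ x.
Proof. intros <- T x; apply comp_assoc. Qed.

Lemma comp_eq_assoc2 (E : Category) (A B B' C : Ob E) (f : Hom B C) (g : Hom A B)
    (f' : Hom B' C) (g' : Hom A B') : f ∘ g = f' ∘ g' ->
  forall (T : Ob E) (x : Hom T A), f ∘ (g ∘ x) = f' ∘ (g' ∘ x).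
Proof. intros e T x; rewrite !comp_assoc; now rewrite e. Qed.

(* [rw] and [rwl] rewrite modulo associativity: composites are kept nested to the
   right, and an equation [f ∘ g = h] is also used as [f ∘ (g ∘ x) = h ∘ x]. *)
Ltac ra := rewrite <- ?comp_assoc.
Ltac rw H :=
  ra; first [rewrite (comp_eq_assoc2 H) | rewrite (comp_eq_assoc H) | rewrite H];
  ra; rewrite ?comp_idl, ?comp_idr.
Ltac rwl H :=
  ra; first [rewrite <- (comp_eq_assoc2 H)
            | rewrite (comp_eq_assoc (eq_sym H)) | rewrite <- H];
  ra; rewrite ?comp_idl, ?comp_idr.

(** * Finite limits *)

Section FiniteLimits.

Variable E : Category.
Hypothesis lim : HasFiniteLimits E.

Definition EmptyCat : Category.
Proof.
refine {| Ob := Empty_set; Hom := fun _ _ => unit; idm := fun _ => tt;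
          comp := fun _ _ _ _ _ => tt |}; intros [].
Defined.

Definition empty_functor : Functor EmptyCat E.
Proof.
unshelve refine {| fob := fun j : Ob EmptyCat => match j with end |}; intros [].
Defined.

Lemma has_terminal : HasTerminal E.
Proof.
destruct (lim (J := EmptyCat) empty_functor) as (L & pi & _ & univ).
{ split; [exists []; intros []|intros []]. }
exists L; intros T.
destruct (univ T (fun j : Ob EmptyCat => match j with end)) as (u & _ & uq).
{ intros []. }
exists u; split; [trivial|]; intros v _; apply uq; intros [].
Qed.

(** [None] is the common target of the cospan, [Some false] and [Some true] are its sources. Hom
    types have at most one element, so the category laws are automatic. *)
Definition CospanHom (a b : option bool) : Type :=
  match a, b with
  | None, None => unit
  | Some _, None => unit
  | Some false, Some false => unit
  | Some true, Some true => unit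
  | _, _ => Empty_set
  end.

Definition cospan_id (a : option bool) : CospanHom a a :=
  match a with None => tt | Some true => tt | Some false => tt end.

Definition cospan_comp (a b c : option bool) :
  CospanHom b c -> CospanHom a b -> CospanHom a c.
Proof.
destruct a as [[]|], b as [[]|], c as [[]|]; simpl; intros x y;
  solve [exact tt | contradiction].
Defined.

Lemma CospanHom_eq (a b : option bool) (x y : CospanHom a b) : x = y.
Proof.
destruct a as [[]|], b as [[]|]; simpl in *; destruct x, y; reflexivity.
Qed.

Definition Cospan : Category := {|
  Ob := option bool;
  Hom := CospanHom;
  idm := cospan_id;
  comp := cospan_comp;
  comp_idl := fun a b f => CospanHom_eq _ _;
  comp_idr := fun a b f => CospanHom_eq _ _;
  comp_assoc := fun a b c d h g f => CospanHom_eq _ _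
|}.

Definition cospan_functor (A B C : Ob E) (f : Hom A C) (g : Hom B C) :
  Functor Cospan E.
Proof.
unshelve refine {|
  fob := fun j : Ob Cospan =>
    match j with None => C | Some false => A | Some true => B end |}.
- intros [[]|] [[]|] h; simpl in *; try contradiction;
    first [exact f | exact g | apply idm].
- intros [[]|]; reflexivity.
- intros [[]|] [[]|] [[]|] h k; simpl in *; try contradiction;
    rewrite ?comp_idl, ?comp_idr; reflexivity.
Defined.

Lemma cospan_finite : IsFiniteCategory Cospan.
Proof.
split.
- exists [None; Some false; Some true]; intros [[]|]; simpl; auto.
- intros [[]|] [[]|]; simpl;
    solve [exists []; intros [] | exists [tt]; intros []; simpl; auto].
Qed.

Lemma has_pullbacks : HasPullbacks E.
Proof.
intros A B C f g.
destruct (lim (cospan_functor f g) cospan_finite) as (L & pi & cone & univ).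
assert (ef := cone (Some false) None tt); assert (eg := cone (Some true) None tt).
simpl in ef, eg.
exists L, (pi (Some false)), (pi (Some true)); split; [congruence|].
intros T a b e.
destruct (univ T (fun j : Ob Cospan => match j with
    None => f ∘ a | Some false => a | Some true => b end)) as (u & uE & uq).
{ intros [[]|] [[]|] h; simpl in *; try contradiction; rewrite ?comp_idl; auto. }
exists u; split; [exact (conj (uE (Some false)) (uE (Some true)))|].
intros v [va vb]; apply uq; intros [[]|]; auto.
simpl; rewrite <- ef, <- va; apply eq_sym, comp_assoc.
Qed.

Lemma has_products : HasBinaryProducts E.
Proof.
intros A B.
destruct has_terminal as [I HI].
destruct (HI A) as (a & _ & aq), (HI B) as (b & _ & bq).
destruct (has_pullbacks a b) as (Q & p1 & p2 & _ & univ).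
exists Q, p1, p2; intros T x y; apply univ.
destruct (HI T) as (t & _ & tq).
now rewrite <- (tq (a ∘ x) Logic.I), <- (tq (b ∘ y) Logic.I).
Qed.

(** The equaliser is the pullback of the graphs [(id, u)] and [(id, v)]; comparing first components
    shows that its two projections coincide. *)
Lemma has_equalizers (A B : Ob E) (u v : Hom A B) :
  exists (D : Ob E) (d : Hom D A), IsMono d /\ u ∘ d = v ∘ d /\
    forall (T : Ob E) (t : Hom T A), u ∘ t = v ∘ t -> exists s : Hom T D, d ∘ s = t.
Proof.
destruct (has_products A B) as (Q & p1 & p2 & HQ).
destruct (HQ A (idm A) u) as (uu & [u1 u2] & _).
destruct (HQ A (idm A) v) as (vv & [v1 v2] & _).
destruct (has_pullbacks uu vv) as (D & d & d' & e & univ).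
assert (d' = d) as ->.
{ rewrite <- (comp_idl d'), <- v1; rwl e; rw u1; reflexivity. }
exists D, d; split; [|split].
- intros T a b ab.
  destruct (univ T (d ∘ a) (d ∘ a)) as (w & _ & wq); [rw e; reflexivity|].
  rewrite <- (wq a), <- (wq b); auto.
- rewrite <- u2, <- v2; rw e; reflexivity.
- intros T t et.
  destruct (univ T t t) as (s & [es _] & _); [|now exists s].
  destruct (HQ T t (u ∘ t)) as (z & _ & zq).
  rewrite <- (zq (uu ∘ t)), <- (zq (vv ∘ t)); auto; split; rewrite comp_assoc.
  + now rewrite v1, comp_idl.
  + now rewrite v2.
  + now rewrite u1, comp_idl.
  + now rewrite u2.
Qed.

End FiniteLimits.

(** * Relations as spans, and pullbacks through generalised elements *)

Definition JointlyMonic (E : Category) (R X Y : Ob E)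
    (r1 : Hom R X) (r2 : Hom R Y) : Prop :=
  forall (T : Ob E) (a b : Hom T R), r1 ∘ a = r1 ∘ b -> r2 ∘ a = r2 ∘ b -> a = b.

(** Membership of the generalised element [(a, b)] at stage [K]; the same formula serves relations,
    pseudo relations and weak pullbacks. *)
Definition Related (E : Category) (R X Y : Ob E) (r1 : Hom R X) (r2 : Hom R Y)
    (K : Ob E) (a : Hom K X) (b : Hom K Y) : Prop :=
  exists c : Hom K R, r1 ∘ c = a /\ r2 ∘ c = b.

Lemma pullback_lift (E : Category) (A B C V : Ob E) (f : Hom A C) (g : Hom B C)
    (p1 : Hom V A) (p2 : Hom V B) : IsPullback f g p1 p2 ->
  forall (T : Ob E) (a : Hom T A) (b : Hom T B), f ∘ a = g ∘ b ->
  exists u : Hom T V, p1 ∘ u = a /\ p2 ∘ u = b.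
Proof. intros [_ pb] T a b e; destruct (pb T a b e) as (u & ue & _); eauto. Qed.

Lemma pullback_jointly_monic (E : Category) (A B C V : Ob E) (f : Hom A C) (g : Hom B C)
    (p1 : Hom V A) (p2 : Hom V B) : IsPullback f g p1 p2 -> JointlyMonic p1 p2.
Proof.
intros [e pb] T a b ea eb.
destruct (pb T (p1 ∘ a) (p2 ∘ a)) as (u & _ & uq); [rw e; reflexivity|].
rewrite <- (uq a), <- (uq b); auto.
Qed.

Lemma pullback_of_lift (E : Category) (A B C V : Ob E) (f : Hom A C) (g : Hom B C)
    (p1 : Hom V A) (p2 : Hom V B) :
  f ∘ p1 = g ∘ p2 -> JointlyMonic p1 p2 ->
  (forall (T : Ob E) (a : Hom T A) (b : Hom T B), f ∘ a = g ∘ b ->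
     Related p1 p2 a b) -> IsPullback f g p1 p2.
Proof.
intros e jm l; split; [exact e|].
intros T a b ab; destruct (l T a b ab) as (u & ua & ub).
exists u; split; [auto|]; intros v [va vb]; apply jm; congruence.
Qed.

Lemma regular_epi_epi (E : Category) (A B : Ob E) (r : Hom A B) : IsRegularEpi r ->
  forall (T : Ob E) (a b : Hom B T), a ∘ r = b ∘ r -> a = b.
Proof.
intros (R & r1 & r2 & e & univ) T a b ab.
destruct (univ T (a ∘ r)) as (u & _ & uq); [rw e; reflexivity|].
rewrite <- (uq a), <- (uq b); auto.
Qed.

Lemma projective_retract (E : Category) (P Q : Ob E) (s : Hom P Q) (r : Hom Q P) :
  r ∘ s = idm P -> IsProjective Q -> IsProjective P.
Proof.
intros rs pQ A B q f rq.
destruct (pQ A B q (f ∘ r) rq) as [f' e].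
exists (f' ∘ s); rw e; rw rs; reflexivity.
Qed.

(** * Exact categories with enough projectives *)

Section Cover.

Variables (E : Category) (S : Ob E -> Prop).
Hypothesis exactE : IsExact E.
Hypothesis cov : IsProjectiveCover S.

Let lim : HasFiniteLimits E := proj1 exactE.

Lemma cover (A : Ob E) : exists (X : Ob E) (q : Hom X A), S X /\ IsRegularEpi q.
Proof.
destruct (proj2 cov A) as ([X sX] & q & rq); now exists X, q.
Qed.

Lemma S_projective (X : Ob E) : S X -> IsProjective X.
Proof. intros sX; exact (proj1 cov (exist _ X sX)). Qed.

Lemma eq_on_points (A B : Ob E) (f g : Hom A B) :
  (forall (K : Ob E) (k : Hom K A), S K -> f ∘ k = g ∘ k) -> f = g.
Proof.
intros fg; destruct (cover A) as (X & q & sX & rq).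
apply (regular_epi_epi rq); auto.
Qed.

(** A point of the parallel pair coequalised by [r] gives maps [j], [j'] with equal image under [r],
    so [v] coequalises that pair. *)
Lemma descend (A B N : Ob E) (r : Hom A B) (v : Hom A N) : IsRegularEpi r ->
  (forall (K : Ob E) (j j' : Hom K A), S K -> r ∘ j = r ∘ j' -> v ∘ j = v ∘ j') ->
  exists u : Hom B N, u ∘ r = v.
Proof.
intros (R & r1 & r2 & e & univ) rv.
destruct (univ N v) as (u & ue & _); [|now exists u].
apply eq_on_points; intros K k sK; ra; apply rv; [auto|].
now rw e.
Qed.

(** A cover of [T] is itself a point; joint monicity makes its witness constant on the fibres of the
    cover, so the witness descends to [T]. *)
Lemma related_on_points (R X Y T : Ob E) (r1 : Hom R X) (r2 : Hom R Y)
    (a : Hom T X) (b : Hom T Y) : JointlyMonic r1 r2 ->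
  (forall (K : Ob E) (k : Hom K T), S K -> Related r1 r2 (a ∘ k) (b ∘ k)) ->
  Related r1 r2 a b.
Proof.
intros jm ab; destruct (cover T) as (K & q & sK & rq).
destruct (ab K q sK) as (c & c1 & c2).
destruct (@descend K T R q c rq) as [u <-].
- intros L j j' _ jj; apply jm.
  + rw c1; rw jj; rwl c1; reflexivity.
  + rw c2; rw jj; rwl c2; reflexivity.
- exists u; split; apply (regular_epi_epi rq); ra; auto.
Qed.

Lemma factor_on_points (A B T : Ob E) (m : Hom A B) (t : Hom T B) : IsMono m ->
  (forall (K : Ob E) (k : Hom K T), S K -> exists u : Hom K A, m ∘ u = t ∘ k) ->
  exists u : Hom T A, m ∘ u = t.
Proof.
intros mm h; destruct (@related_on_points A B B T m m t t) as (u & ue & _).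
- intros L a b ab _; now apply mm.
- intros K k sK; destruct (h K k sK) as [u ue]; now exists u.
- now exists u.
Qed.

(** Each structure map of an equivalence relation is a witness at a generic element: the identity of
    [X], the pair [r2], [r1], and the outer legs of the pullback of [r2] and [r1]. *)
Lemma quotient (R X : Ob E) (r1 r2 : Hom R X) : JointlyMonic r1 r2 ->
  (forall (K : Ob E) (a : Hom K X), S K -> Related r1 r2 a a) ->
  (forall (K : Ob E) (a b : Hom K X), S K -> Related r1 r2 a b -> Related r1 r2 b a) ->
  (forall (K : Ob E) (a b c : Hom K X), S K ->
     Related r1 r2 a b -> Related r1 r2 b c -> Related r1 r2 a c) ->
  exists (Q : Ob E) (q : Hom X Q), IsRegularEpi q /\
    forall (K : Ob E) (a b : Hom K X), q ∘ a = q ∘ b <-> Related r1 r2 a b.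
Proof.
intros jm hr hs ht.
destruct (proj2 (proj2 exactE) R X r1 r2) as (Q & q & coeq & ker).
- split; [|split; [|split]].
  + destruct (has_products lim X X) as (XX & pi1 & pi2 & prod).
    destruct (prod R r1 r2) as (m & [m1 m2] & _).
    exists XX, pi1, pi2, m; repeat split; auto.
    intros T a b ab; apply jm; [rewrite <- m1|rewrite <- m2]; ra; now rewrite ab.
  + destruct (@related_on_points R X X X r1 r2 (idm X) (idm X) jm) as [u ?]; [|now exists u].
    intros K k sK; now apply hr.
  + destruct (@related_on_points R X X R r1 r2 r2 r1 jm) as [u ?]; [|now exists u].
    intros K k sK; apply hs; [auto|]; now exists k.
  + destruct (has_pullbacks lim r2 r1) as (W & p1 & p2 & pb).
    destruct (@related_on_points R X X W r1 r2 (r1 ∘ p1) (r2 ∘ p2) jm) as [tau ?].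
    * intros K k sK; apply ht with (b := r2 ∘ p1 ∘ k); [auto| |].
      -- exists (p1 ∘ k); split; apply comp_assoc.
      -- exists (p2 ∘ k); split; [rwl (proj1 pb)|ra]; reflexivity.
    * now exists W, p1, p2, tau.
- exists Q, q; split; [now exists R, r1, r2|].
  intros K a b; split.
  + intros ab; exact (pullback_lift ker ab).
  + intros (c & <- & <-); rw (proj1 coeq); reflexivity.
Qed.

(** The image is the quotient by the kernel pair. The induced [m] is monic because points of [I]
    lift along [e], which identifies exactly what [f] identifies. *)
Lemma image (A B : Ob E) (f : Hom A B) :
  exists (I : Ob E) (e : Hom A I) (m : Hom I B),
    IsRegularEpi e /\ IsMono m /\ m ∘ e = f.
Proof.
destruct (has_pullbacks lim f f) as (R & r1 & r2 & pb).
assert (rel : forall (K : Ob E) (a b : Hom K A),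
  Related r1 r2 a b <-> f ∘ a = f ∘ b).
{ intros K a b; split; [|apply (pullback_lift pb)].
  intros (c & <- & <-); rw (proj1 pb); reflexivity. }
destruct (@quotient R A r1 r2 (pullback_jointly_monic pb)) as (I & e & re & eE).
1-3: intros; rewrite ?rel in *; congruence.
destruct (@descend A I B e f re) as [m me].
{ intros K j j' _ jj; now apply rel, eE. }
exists I, e, m; repeat split; auto.
intros T a b ab; apply eq_on_points; intros K k sK.
destruct (S_projective sK (a ∘ k) re) as [a' ea].
destruct (S_projective sK (b ∘ k) re) as [b' eb].
rewrite <- ea, <- eb; apply eE, rel.
rewrite <- me; rw ea; rw eb; rw ab; reflexivity.
Qed.

(** Points lift along the mono part [m] of the image factorisation, so the identity factors through
    it; thus [m] is invertible and [r] inherits the coequaliser property of [e]. *)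
Lemma regular_epi_on_points (A B : Ob E) (r : Hom A B) :
  (forall (K : Ob E) (k : Hom K B), S K -> exists l : Hom K A, r ∘ l = k) ->
  IsRegularEpi r.
Proof.
intros rl; destruct (image r) as (I & e & m & re & mm & me).
destruct (@factor_on_points I B B m (idm B) mm) as [n mn].
{ intros K k sK; destruct (rl K k sK) as [l <-].
  exists (e ∘ l); rw me; reflexivity. }
assert (nm : n ∘ m = idm I) by (apply mm; rw mn; reflexivity).
destruct re as (R & r1 & r2 & ee & univ).
exists R, r1, r2; rewrite <- me; split; [ra; now rewrite ee|].
intros T h hh; destruct (univ T h hh) as (u & ue & uq).
exists (u ∘ n); split; [rw nm; exact ue|].
intros v ve; rewrite (uq (v ∘ m)); [rw mn; reflexivity|].
now ra.
Qed.

Lemma pullback_cover (A B C : Ob E) (f : Hom A C) (g : Hom B C) :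
  exists (X : Ob E) (x1 : Hom X A) (x2 : Hom X B), S X /\ f ∘ x1 = g ∘ x2 /\
    forall (K : Ob E) (a : Hom K A) (b : Hom K B), IsProjective K ->
    f ∘ a = g ∘ b -> Related x1 x2 a b.
Proof.
destruct (has_pullbacks lim f g) as (V & p1 & p2 & pb).
destruct (cover V) as (X & q & sX & rq).
exists X, (p1 ∘ q), (p2 ∘ q); repeat split; [auto|rw (proj1 pb); reflexivity|].
intros K a b pK ab; destruct (pullback_lift pb ab) as (u & ua & ub).
destruct (pK _ _ q u rq) as [l lu].
exists l; split; ra; now rewrite lu.
Qed.

Lemma IsWeakPullback_FullSub (A B C V : Ob (FullSub S)) (f : Hom A C) (g : Hom B C)
    (p1 : Hom V A) (p2 : Hom V B) :
  IsWeakPullback f g p1 p2 <->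
  comp (c := E) f p1 = comp (c := E) g p2 /\
  forall (K : Ob E) (a : Hom K (proj1_sig A)) (b : Hom K (proj1_sig B)), S K ->
  comp (c := E) f a = comp (c := E) g b -> Related (E := E) p1 p2 a b.
Proof.
split; intros [e univ]; (split; [exact e|]).
- intros K a b sK; exact (univ (exist _ K sK) a b).
- intros [K sK] a b; exact (univ K a b sK).
Qed.

(** * The conditions (a), (b), (c) *)

Definition PullbacksProjective : Prop :=
  forall (Z X U A : Ob E) (a : Hom Z U) (b : Hom X U) (p1 : Hom A Z) (p2 : Hom A X),
    S Z -> S X -> S U -> IsPullback a b p1 p2 -> IsProjective A.

(** If the pullback [A] is projective, the comparison [q] from the weak pullback splits, and [s ∘ q]
    is the idempotent. Conversely, an idempotent determined by projections on a cover of [A]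
    descends to a section of that cover. *)
Lemma pullbacks_projective_idempotents :
  PullbacksProjective <-> WeakPullbacksHaveIdempotents (FullSub S).
Proof.
split.
- intros star Z X U V a b p1 p2 wpb.
  destruct (proj1 (IsWeakPullback_FullSub a b p1 p2) wpb) as [e univ].
  destruct (has_pullbacks lim a b) as (A & q1 & q2 & pb).
  assert (pA : IsProjective A)
    by (apply (star _ _ _ _ a b q1 q2); auto; apply proj2_sig).
  destruct (pullback_lift pb e) as (q & qe1 & qe2).
  assert (rq : IsRegularEpi q).
  { apply regular_epi_on_points; intros K k sK.
    destruct (univ K (q1 ∘ k) (q2 ∘ k) sK) as (l & l1 & l2).
    { rw (proj1 pb); reflexivity. }
    exists l; apply (pullback_jointly_monic pb); [rw qe1|rw qe2]; auto. }
  destruct (pA _ _ q (idm A) rq) as [s qs].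
  exists (comp (c := E) s q); split; [|split; [|split]]; cbn in *.
  + rw qs; reflexivity.
  + intros T h k eh ek; cbn in *; ra.
    rewrite (pullback_jointly_monic pb (a := q ∘ h) (b := q ∘ k));
      [reflexivity|rw qe1; rw qe1|rw qe2; rw qe2]; auto.
  + rewrite <- qe1; rw qs; reflexivity.
  + rewrite <- qe2; rw qs; reflexivity.
- intros idem Z X U A a b p1 p2 sZ sX sU pb.
  destruct (cover A) as (V & q & sV & rq).
  destruct (idem (exist _ Z sZ) (exist _ X sX) (exist _ U sU) (exist _ V sV)
    a b (p1 ∘ q) (p2 ∘ q)) as (i & _ & det & i1 & i2).
  { apply IsWeakPullback_FullSub; split; [cbn; rw (proj1 pb); reflexivity|].
    intros K x y sK exy; cbn in *.
    destruct (pullback_lift pb exy) as (k & k1 & k2).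
    destruct (S_projective sK k rq) as [l lk].
    exists l; split; ra; now rewrite lk. }
  cbn in i1, i2; rewrite <- comp_assoc in i1, i2.
  destruct (@descend V A V q i rq) as [s sq].
  { intros K j j' sK jj; apply (det (exist _ K sK) j j'); cbn; rw jj; reflexivity. }
  apply projective_retract with (s := s) (r := q); [|now apply S_projective].
  apply (regular_epi_epi rq); rw sq.
  apply (pullback_jointly_monic pb); ra; auto.
Qed.

Lemma split_cover (P : Ob E) : IsProjective P ->
  exists (X : Ob E) (s : Hom P X) (r : Hom X P), S X /\ r ∘ s = idm P.
Proof.
intros pP; destruct (cover P) as (X & r & sX & rr).
destruct (pP _ _ r (idm P) rr) as [s rs]; now exists X, s, r.
Qed.

(** Projectives are retracts of objects of [S]; the retractions make [A] a retract of the pullback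
    [A'] of a cospan in [S]. *)
Lemma pullback_of_projectives : PullbacksProjective ->
  forall (Z X U A : Ob E) (a : Hom Z U) (b : Hom X U) (p1 : Hom A Z) (p2 : Hom A X),
  IsProjective Z -> IsProjective X -> IsProjective U ->
  IsPullback a b p1 p2 -> IsProjective A.
Proof.
intros star Z X U A a b p1 p2 pZ pX pU pb.
destruct (split_cover pZ) as (Z' & sZ & rZ & SZ & eZ).
destruct (split_cover pX) as (X' & sX & rX & SX & eX).
destruct (split_cover pU) as (U' & sU & rU & SU & eU).
destruct (has_pullbacks lim (sU ∘ a ∘ rZ) (sU ∘ b ∘ rX)) as (A' & p1' & p2' & pb').
destruct (pullback_lift pb' (a := sZ ∘ p1) (b := sX ∘ p2)) as (s & s1 & s2).
{ rw eZ; rw eX; rw (proj1 pb); reflexivity. }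
destruct (pullback_lift pb (a := rZ ∘ p1') (b := rX ∘ p2')) as (r & r1 & r2).
(* The square of [A'] ends in [U']; applying [rU] cancels [sU]. *)
{ assert (e := proj1 pb'); rewrite <- !comp_assoc in e.
  apply (f_equal (fun x => rU ∘ x)) in e; revert e; rw eU; rw eU; auto. }
apply projective_retract with (s := s) (r := r).
- apply (pullback_jointly_monic pb).
  + rw r1; rw s1; rw eZ; reflexivity.
  + rw r2; rw s2; rw eX; reflexivity.
- apply (star _ _ _ _ _ _ _ _ SZ SX SU pb').
Qed.

(** For the converse, the map from a cover of [A] to the pullback [L] formed among projectives
    descends to a section of [u], so [A] is a retract of [L]. *)
Lemma pullbacks_projective_projectives_have_pullbacks :
  PullbacksProjective <-> ProjectivesHavePullbacks E.
Proof.
split.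
- intros star [A pA] [B pB] [C pC] f g; cbn in *.
  destruct (has_pullbacks lim f g) as (V & p1 & p2 & pb).
  unshelve eexists (exist _ V _), p1, p2.
  + exact (pullback_of_projectives star pA pB pC pb).
  + split; [exact (proj1 pb)|]; intros [T pT] a b; exact (proj2 pb T a b).
- intros hp Z X U A a b p1 p2 sZ sX sU pb.
  pose (inj Y sY := exist (@IsProjective E) Y (S_projective sY)).
  destruct (hp (inj Z sZ) (inj X sX) (inj U sU) a b) as ([L pL] & l1 & l2 & pbL).
  assert (eL := proj1 pbL); cbn in eL, l1, l2.
  destruct (pullback_lift pb eL) as (u & u1 & u2).
  destruct (cover A) as (K & q & sK & rq).
  destruct (pullback_lift pbL (T := inj K sK) (a := p1 ∘ q) (b := p2 ∘ q))
    as (l & le1 & le2).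
  { cbn; rw (proj1 pb); reflexivity. }
  cbn in l, le1, le2.
  destruct (@descend K A L q l rq) as [m mq].
  { intros K' j j' sK' jj.
    apply (pullback_jointly_monic pbL (T := inj K' sK')); cbn.
    - rw le1; rw jj; rwl le1; reflexivity.
    - rw le2; rw jj; rwl le2; reflexivity. }
  apply projective_retract with (s := m) (r := u); [|exact pL].
  apply (regular_epi_epi rq); rw mq.
  apply (pullback_jointly_monic pb); [rw u1|rw u2]; auto.
Qed.

(** * Slice categories and condition (a) *)

Definition slice_hom (A : Ob E) (x y : Ob (Slice A))
    (h : Hom (slice_dom x) (slice_dom y)) (e : slice_map y ∘ h = slice_map x) :
  Hom x y := exist _ h e.

Lemma slice_product (A : Ob E) (x y z : Ob (Slice A)) (p1 : Hom z x) (p2 : Hom z y) :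
  IsProduct p1 p2 <->
  IsPullback (slice_map x) (slice_map y) (proj1_sig p1) (proj1_sig p2).
Proof.
split.
- intros prod; split; [now rewrite (proj2_sig p1), (proj2_sig p2)|].
  intros T a b e.
  pose (t := {| slice_dom := T; slice_map := slice_map x ∘ a |} : Ob (Slice A)).
  destruct (prod t (@slice_hom A t x a eq_refl) (@slice_hom A t y b (eq_sym e)))
    as (u & [u1 u2] & uq).
  apply (f_equal (@proj1_sig _ _)) in u1, u2.
  exists (proj1_sig u); split; [split; [exact u1|exact u2]|].
  intros v [v1 v2].
  assert (ve : slice_map z ∘ v = slice_map t).
  { rewrite <- (proj2_sig p1); rw v1; reflexivity. }
  specialize (uq (@slice_hom A t z v ve)).
  rewrite uq; [reflexivity|split; apply SliceHom_eq; auto].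
- intros [e univ] t a b.
  destruct (univ _ (proj1_sig a) (proj1_sig b)) as (u & [u1 u2] & uq).
  { now rewrite (proj2_sig a), (proj2_sig b). }
  assert (ue : slice_map z ∘ u = slice_map t).
  { rewrite <- (proj2_sig p1); rw u1; exact (proj2_sig a). }
  exists (@slice_hom A t z u ue); split; [split; apply SliceHom_eq; auto|].
  intros v [<- <-]; apply SliceHom_eq, uq; auto.
Qed.

Lemma slice_regular_epi (A : Ob E) (x y : Ob (Slice A)) (r : Hom x y) :
  IsRegularEpi r <-> IsRegularEpi (proj1_sig r).
Proof.
split; intros (R & r1 & r2 & e & univ).
- exists (slice_dom R), (proj1_sig r1), (proj1_sig r2).
  split; [exact (f_equal (@proj1_sig _ _) e)|].
  intros T h hh.
  (* Maps over [A] into the projection [A × T -> A] amount to plain maps into [T], which transfers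
     the universal property out of the slice. *)
  destruct (has_products lim A T) as (AT & pA & pT & prod).
  destruct (prod _ (slice_map x) h) as (hA & [hA1 hA2] & _).
  pose (t := {| slice_dom := AT; slice_map := pA |} : Ob (Slice A)).
  destruct (univ t (@slice_hom A x t hA hA1)) as ([u uA] & ue & uq).
  { apply SliceHom_eq; cbn.
    destruct (prod _ (slice_map R) (h ∘ proj1_sig r1)) as (z & _ & zq).
    rewrite <- (zq (hA ∘ proj1_sig r1)), <- (zq (hA ∘ proj1_sig r2)); auto;
      split; rewrite comp_assoc, ?hA1, ?hA2; auto;
      first [exact (proj2_sig r1) | exact (proj2_sig r2)]. }
  apply (f_equal (@proj1_sig _ _)) in ue; subst t; cbn in *.
  exists (pT ∘ u); split; [rw ue; exact hA2|].
  intros v vr.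
  destruct (prod _ (slice_map y) v) as (vA & [vA1 vA2] & _).
  specialize (uq (exist _ vA vA1)); apply (f_equal (@proj1_sig _ _)) in uq;
    [cbn in uq; subst u; exact vA2|].
  apply SliceHom_eq; cbn.
  destruct (prod _ (slice_map x) h) as (z & _ & zq).
  rewrite <- (zq (vA ∘ proj1_sig r)), <- (zq hA); auto.
  split; rewrite comp_assoc, ?vA1, ?vA2; auto; apply (proj2_sig r).
- assert (e1 : slice_map x ∘ r1 = slice_map x ∘ r2).
  { rewrite <- (proj2_sig r); rw e; reflexivity. }
  pose (R' := {| slice_dom := R; slice_map := slice_map x ∘ r1 |} : Ob (Slice A)).
  exists R', (@slice_hom A R' x r1 eq_refl), (@slice_hom A R' x r2 (eq_sym e1)).
  split; [apply SliceHom_eq, e|].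
  intros t h hh; apply (f_equal (@proj1_sig _ _)) in hh; cbn in hh.
  destruct (univ _ (proj1_sig h) hh) as (u & ue & uq).
  assert (uA : slice_map t ∘ u = slice_map y).
  { apply (@regular_epi_epi E _ _ (proj1_sig r)); [now exists R, r1, r2|].
    rw ue; now rewrite (proj2_sig h), (proj2_sig r). }
  exists (@slice_hom A y t u uA); split; [apply SliceHom_eq, ue|].
  intros v <-; apply SliceHom_eq, uq; reflexivity.
Qed.

Lemma slice_projective (A : Ob E) (x : Ob (Slice A)) :
  IsProjective x <-> IsProjective (slice_dom x).
Proof.
split; intros px.
- destruct (cover (slice_dom x)) as (X & q & sX & rq).
  pose (x' := {| slice_dom := X; slice_map := slice_map x ∘ q |} : Ob (Slice A)).
  pose (q' := @slice_hom A x' x q eq_refl).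
  destruct (px x' x q' (idm x)) as [s qs]; [now apply slice_regular_epi|].
  apply projective_retract with (s := proj1_sig s) (r := q).
  + exact (f_equal (@proj1_sig _ _) qs).
  + now apply S_projective.
- intros y z r f rr; apply slice_regular_epi in rr.
  destruct (px _ _ (proj1_sig r) (proj1_sig f) rr) as [f' e].
  assert (e' : slice_map y ∘ f' = slice_map x).
  { rewrite <- (proj2_sig r); rw e; exact (proj2_sig f). }
  exists (@slice_hom A x y f' e'); apply SliceHom_eq, e.
Qed.

(** Covering [C] by [T] in [S] makes [T ×_U P] a pullback of projectives, on which lifting problems
    are solvable. For the converse, internal projectivity is applied to a cover of [A = Z ×_U X] and
    the identity of [A]. *)
Lemma pullbacks_projective_slices :
  PullbacksProjective <-> SliceProjectivesInternallyProjective S.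
Proof.
split.
- intros star [U sU] P pP C A B CP p1 p2 r f prod rr; cbn in *.
  apply slice_projective in pP; apply slice_product in prod.
  apply slice_regular_epi in rr.
  destruct (cover (slice_dom C)) as (T & t & sT & rt).
  destruct (has_pullbacks lim (slice_map C ∘ t) (slice_map P)) as (TP & q1 & q2 & pb).
  assert (pTP := pullback_of_projectives star (S_projective sT) pP (S_projective sU) pb).
  destruct (pullback_lift prod (a := t ∘ q1) (b := q2)) as (m & m1 & m2).
  { rewrite <- (proj1 pb); apply comp_assoc. }
  destruct (pTP _ _ (proj1_sig r) (proj1_sig f ∘ m) rr) as [f' e].
  pose (T' := {| slice_dom := T; slice_map := slice_map C ∘ t |} : Ob (Slice U)).
  pose (TP' := {| slice_dom := TP; slice_map := slice_map C ∘ t ∘ q1 |} : Ob (Slice U)).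
  assert (me : slice_map CP ∘ m = slice_map TP').
  { rewrite <- (proj2_sig p1); rw m1; cbn; now ra. }
  assert (fe : slice_map A ∘ f' = slice_map TP').
  { rewrite <- (proj2_sig r); rw e; now rw (proj2_sig f). }
  exists T', TP', (@slice_hom U TP' T' q1 eq_refl),
    (@slice_hom U TP' P q2 (eq_sym (proj1 pb))), (@slice_hom U T' C t eq_refl),
    (@slice_hom U TP' CP m me), (@slice_hom U TP' A f' fe).
  split; [now apply slice_product|split; [now apply slice_regular_epi|]].
  split; [split|]; now apply SliceHom_eq.
- intros slices Z X U A a b p1 p2 sZ sX sU pb.
  destruct (cover A) as (K & q & sK & rq).
  pose (P := {| slice_dom := X; slice_map := b |} : Ob (Slice U)).
  pose (C := {| slice_dom := Z; slice_map := a |} : Ob (Slice U)).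
  pose (CP := {| slice_dom := A; slice_map := a ∘ p1 |} : Ob (Slice U)).
  pose (K' := {| slice_dom := K; slice_map := a ∘ p1 ∘ q |} : Ob (Slice U)).
  pose (p1' := @slice_hom U CP C p1 eq_refl).
  pose (p2' := @slice_hom U CP P p2 (eq_sym (proj1 pb))).
  pose (q' := @slice_hom U K' CP q eq_refl).
  destruct (slices (exist _ U sU) P) with (p1 := p1') (p2 := p2') (r := q') (f := idm CP)
    as (T & TP & q1 & q2 & t & m & f' & prod & rt & [m1 m2] & e).
  { apply slice_projective; now apply S_projective. }
  { now apply slice_product. }
  { now apply slice_regular_epi. }
  apply slice_product in prod; apply slice_regular_epi in rt.
  apply (f_equal (@proj1_sig _ _)) in m1, m2, e.
  destruct T as [T aT], TP as [TP aTP], q1 as [q1 q1E], q2 as [q2 q2E], t as [t tE],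
    m as [m mE], f' as [f' fE].
  subst P C CP K' p1' p2' q'; cbn in *; rewrite comp_idl in e.
  (* [Z] is projective, so [t] splits; restricting [f'] along the splitting gives a section of the
     cover [q]. *)
  destruct (S_projective sZ (idm Z) rt) as [s ts].
  destruct (pullback_lift prod (a := s ∘ p1) (b := p2)) as (n & n1 & n2).
  { rewrite <- tE; rw ts; exact (proj1 pb). }
  apply projective_retract with (s := f' ∘ n) (r := q);
    [|now apply S_projective].
  apply (pullback_jointly_monic pb); rw e.
  + rw m1; rw n1; rw ts; reflexivity.
  + rw m2; exact n2.
Qed.

(** * From weak dependent products to exponentials *)

Lemma joint_kernel (V A B : Ob E) (p1 : Hom V A) (p2 : Hom V B) :
  exists (K : Ob E) (k1 k2 : Hom K V), p1 ∘ k1 = p1 ∘ k2 /\ p2 ∘ k1 = p2 ∘ k2 /\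
    forall (T : Ob E) (a b : Hom T V), p1 ∘ a = p1 ∘ b -> p2 ∘ a = p2 ∘ b ->
    Related k1 k2 a b.
Proof.
destruct (has_products lim A B) as (AB & pA & pB & prod).
destruct (prod _ p1 p2) as (p & [<- <-] & _).
destruct (has_pullbacks lim p p) as (K & k1 & k2 & pb).
exists K, k1, k2; split; [|split].
- rw (proj1 pb); reflexivity.
- rw (proj1 pb); reflexivity.
- intros T a b ea eb; apply (pullback_lift pb).
  destruct (prod _ (pA ∘ p ∘ a) (pB ∘ p ∘ a)) as (z & _ & zq).
  rewrite <- (zq (p ∘ a)), <- (zq (p ∘ b)); auto; split; now rewrite comp_assoc.
Qed.

(** A cover of the joint kernel in [E] is a weak kernel pair in the subcategory, so the choice of
    weak kernel pair is replaced by a condition on all points. *)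
Lemma preserves_projections_on_points (X W V Yb Y : Ob (FullSub S))
    (p1 : Hom V X) (p2 : Hom V W) (y1 y2 : Hom Yb Y) (f : Hom V Y) :
  PreservesProjections p1 p2 y1 y2 f <->
  forall (K : Ob E) (a b : Hom K (proj1_sig V)), S K ->
    comp (c := E) p1 a = comp (c := E) p1 b ->
    comp (c := E) p2 a = comp (c := E) p2 b ->
    Related (E := E) y1 y2 (comp (c := E) f a) (comp (c := E) f b).
Proof.
split.
- intros (Vb & v1 & v2 & (_ & _ & univ) & fb & e1 & e2) K a b sK ea eb.
  destruct (univ (exist _ K sK) a b ea eb) as (u & <- & <-).
  exists (comp (c := E) fb u); cbn in *; split; [rw e1|rw e2]; reflexivity.
- intros rel.
  destruct (joint_kernel p1 p2) as (K & k1 & k2 & e1 & e2 & univ).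
  destruct (cover K) as (Vb & q & sVb & rq).
  exists (exist _ Vb sVb), (comp (c := E) k1 q), (comp (c := E) k2 q); split.
  + split; [|split]; cbn; [rw e1; reflexivity|rw e2; reflexivity|].
    intros [T sT] a b ea eb; cbn in *.
    destruct (univ T a b ea eb) as (u & <- & <-).
    destruct (S_projective sT u rq) as [u' <-].
    exists u'; split; now ra.
  + apply rel; cbn; [auto|rw e1; reflexivity|rw e2; reflexivity].
Qed.

(* The weak universal property of a dependent product, with a pullback in [E]
   and tested only against objects satisfying [T]. *)
Definition HasGenericSection (T : Ob E -> Prop) (Y X Z : Ob E)
    (g : Hom Y X) (f : Hom X Z) : Prop :=
  exists (W : Ob E) (w : Hom W Z) (Q : Ob E) (p1 : Hom Q X) (p2 : Hom Q W)
      (s : Hom Q Y),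
    T W /\ IsPullback f w p1 p2 /\ g ∘ s = p1 /\
    forall (W' : Ob E) (w' : Hom W' Z) (Q' : Ob E) (p1' : Hom Q' X)
        (p2' : Hom Q' W') (s' : Hom Q' Y),
      T W' -> IsPullback f w' p1' p2' -> g ∘ s' = p1' ->
    exists (h : Hom W' W) (k : Hom Q' Q),
      w ∘ h = w' /\ p1 ∘ k = p1' /\ p2 ∘ k = h ∘ p2' /\ s ∘ k = s'.

Lemma weak_pullback_regular_epi (A B C V Q : Ob E) (f : Hom A C) (g : Hom B C)
    (q1 : Hom Q A) (q2 : Hom Q B) (c : Hom V Q) : IsPullback f g q1 q2 ->
  (forall (K : Ob E) (a : Hom K A) (b : Hom K B), S K -> f ∘ a = g ∘ b ->
     Related (q1 ∘ c) (q2 ∘ c) a b) -> IsRegularEpi c.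
Proof.
intros pb l; apply regular_epi_on_points; intros K k sK.
destruct (l K (q1 ∘ k) (q2 ∘ k) sK) as (u & u1 & u2).
{ rw (proj1 pb); reflexivity. }
exists u; apply (pullback_jointly_monic pb); ra; rewrite <- comp_assoc in u1, u2; auto.
Qed.

Lemma weak_dependent_product_generic_section (Y X Z : Ob E)
    (g : Hom Y X) (f : Hom X Z) : HasWeakDependentProducts (FullSub S) ->
  S Y -> S X -> S Z -> HasGenericSection S g f.
Proof.
intros wdp sY sX sZ.
destruct (wdp (exist _ Y sY) (exist _ X sX) (exist _ Z sZ) g f) as [D univ].
destruct D as [[W sW] w [V sV] p1 p2 e wpb pres over].
unfold IsWeakDependentProduct, IsExtensionalDependentProduct in univ; cbn in *.
destruct (has_pullbacks lim f w) as (Q & q1 & q2 & pb).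
apply IsWeakPullback_FullSub in wpb; destruct wpb as [ew lw]; cbn in *.
destruct (pullback_lift pb ew) as (c & <- & <-).
assert (rc := weak_pullback_regular_epi pb lw).
(* With respect to identities, preservation says that [e] agrees on points with equal projections,
   so it descends to the pullback [Q]. *)
destruct (@descend V Q Y c e rc) as [s <-].
{ intros K j j' sK jj.
  destruct (proj1 (preserves_projections_on_points _ _ _ _ _) pres K j j' sK)
    as (u & u1 & u2); cbn in *; [rw jj; reflexivity|rw jj; reflexivity|].
  rewrite comp_idl in u1, u2; congruence. }
exists W, w, Q, q1, q2, s; split; [auto|split; [auto|split]].
{ apply (regular_epi_epi rc); now ra. }
intros W' w' Q' p1' p2' s' sW' pb' over'.
(* A cover of [Q'] is a weak pullback in the subcategory and yields the competing datum. *)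
destruct (cover Q') as (V' & c' & sV' & rc').
unshelve epose (D' := @Build_DepProdData (FullSub S)
  (exist _ Y sY) (exist _ X sX) (exist _ Z sZ) (exist _ Y sY) g f (idm Y) (idm Y)
  (exist _ W' sW') w' (exist _ V' sV') (p1' ∘ c') (p2' ∘ c') (s' ∘ c') _ _ _).
- apply IsWeakPullback_FullSub; cbn; split; [rw (proj1 pb'); reflexivity|].
  intros K a b sK ab; destruct (pullback_lift pb' ab) as (u & <- & <-).
  destruct (S_projective sK u rc') as [u' <-].
  exists u'; split; now ra.
- apply preserves_projections_on_points; cbn; intros K a b sK ea eb.
  exists (s' ∘ c' ∘ a); rewrite !comp_idl; split; [reflexivity|].
  ra; f_equal; apply (pullback_jointly_monic pb'); now rewrite !comp_assoc.
- cbn; rw over'; reflexivity.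
- destruct (univ D') as (h & k' & eh & e1 & e2 & es); cbn in *.
  destruct (pullback_lift pb (a := p1') (b := h ∘ p2')) as (k & k1 & k2).
  { rw eh; exact (proj1 pb'). }
  exists h, k; split; [auto|split; [auto|split; [auto|]]].
  assert (kc : k ∘ c' = c ∘ k').
  { apply (pullback_jointly_monic pb).
    - rw k1; now rewrite <- e1; ra.
    - rw k2; rewrite <- e2; now ra. }
  apply (regular_epi_epi rc'); rw kc; rewrite <- es; now ra.
Qed.

Section GenericSections.

Hypothesis star : PullbacksProjective.
Hypothesis generic : forall (Y X Z : Ob E) (g : Hom Y X) (f : Hom X Z),
  S Y -> S X -> S Z -> HasGenericSection S g f.

(** [U] is the part of [Z] over which [u] and [v] agree on the whole fibre of [f]. A section, over
    the fibre, of a cover of the equaliser witnesses this; the image forgets the section. *)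
Lemma forall_equal (X Z N : Ob E) (f : Hom X Z) (u v : Hom X N) :
  exists (U : Ob E) (m : Hom U Z), IsMono m /\
    forall (T : Ob E) (t : Hom T Z), (exists s : Hom T U, m ∘ s = t) <->
      forall (K : Ob E) (k : Hom K T) (x : Hom K X), S K ->
        f ∘ x = t ∘ k -> u ∘ x = v ∘ x.
Proof.
destruct (cover Z) as (Z0 & z & sZ & rz).
destruct (pullback_cover f z) as (X0 & x0 & f0 & sX & eX & lX).
destruct (has_equalizers lim (u ∘ x0) (v ∘ x0)) as (D & d & md & ed & ld).
destruct (cover D) as (D0 & q & sD & rq).
destruct (generic (d ∘ q) f0 sD sX sZ)
  as (W & w & Q & p1 & p2 & s & sW & pb & over & univ).
destruct (image (z ∘ w)) as (U & e & m & re & mm & me).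
exists U, m; split; [exact mm|]; intros T t; split.
- intros [r <-] K k x sK fx.
  destruct (S_projective sK (r ∘ k) re) as [l le].
  destruct (lX K x (w ∘ l) (S_projective sK)) as (j & <- & j2).
  { rewrite fx; rwl le; rw me; reflexivity. }
  destruct (pullback_lift pb j2) as (i & i1 & _).
  rewrite <- i1, <- over.
  assert (ed' := f_equal (fun y => y ∘ (q ∘ s ∘ i)) ed); cbn in ed'.
  rewrite <- !comp_assoc in ed'; ra; exact ed'.
- intros ux; apply factor_on_points; [exact mm|]; intros K k sK.
  destruct (S_projective sK (t ∘ k) rz) as [l le].
  destruct (has_pullbacks lim f0 l) as (Q' & p1' & p2' & pb').
  (* Projectivity of the fibre product turns agreement on it into a lift through the cover [q] of
     the equaliser. *)
  assert (pQ := star sX sK sZ pb').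
  destruct (ld Q' p1') as [j je].
  { ra; apply eq_on_points; intros K' k' sK'; ra.
    apply (ux K' (k ∘ (p2' ∘ k'))); [auto|].
    rw eX; rw (proj1 pb'); rw le; reflexivity. }
  destruct (pQ _ _ q j rq) as [s' se].
  destruct (univ K l Q' p1' p2' s' sK pb') as (h & _ & eh & _).
  { rw se; exact je. }
  exists (e ∘ h); rw me; rw eh; exact le.
Qed.

(** [W] parametrises families in [Y], a cover of [N ×_A X], indexed by [X], a cover of [M ×_A Z].
    [U] keeps the families whose values in [N] depend only on the index in [M]. *)
Lemma weak_exponential (A M N : Ob E) (a : Hom M A) (b : Hom N A) :
  exists (U : Ob E) (r : Hom U A) (UM : Ob E) (p1 : Hom UM U) (p2 : Hom UM M)
      (ev : Hom UM N),
    IsPullback r a p1 p2 /\ b ∘ ev = a ∘ p2 /\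
    forall (T : Ob E) (t : Hom T A) (TM : Ob E) (q1 : Hom TM T) (q2 : Hom TM M)
        (phi : Hom TM N),
      S T -> IsPullback t a q1 q2 -> b ∘ phi = a ∘ q2 ->
    exists h : Hom T U, r ∘ h = t /\
      forall (K : Ob E) (i : Hom K TM) (j : Hom K UM), S K ->
        p1 ∘ j = h ∘ (q1 ∘ i) -> p2 ∘ j = q2 ∘ i -> ev ∘ j = phi ∘ i.
Proof.
destruct (cover A) as (Z & z & sZ & rz).
destruct (pullback_cover a z) as (X & xM & f & sX & eX & lX).
destruct (pullback_cover b (a ∘ xM)) as (Y & yN & g & sY & eY & lY).
rewrite <- comp_assoc in eY.
destruct (generic g f sY sX sZ)
  as (W & w & Q & p1 & p2 & s & sW & pbQ & over & univ).
(* [K2] consists of two indices for one member of [W] with the same image in [M]. *)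
destruct (joint_kernel p2 (xM ∘ p1)) as (K2 & k1 & k2 & e1 & e2 & lK).
destruct (forall_equal (p2 ∘ k1) (yN ∘ s ∘ k1) (yN ∘ s ∘ k2)) as (U & m & mm & mE).
destruct (has_pullbacks lim (z ∘ w ∘ m) a) as (UM & u1 & u2 & pbU).
destruct (has_pullbacks lim p2 m) as (QU & j1 & j2 & pbQU).
destruct (pullback_lift pbU (a := j2) (b := xM ∘ (p1 ∘ j1))) as (pi & pi1 & pi2).
{ rwl (proj1 pbQU); rwl (proj1 pbQ); rw eX; reflexivity. }
assert (rpi : IsRegularEpi pi).
{ apply regular_epi_on_points; intros K k sK.
  destruct (lX K (u2 ∘ k) (w ∘ m ∘ u1 ∘ k) (S_projective sK)) as (x & xE & fx).
  { assert (e := f_equal (fun y => y ∘ k) (proj1 pbU)); cbn in e.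
    rewrite <- !comp_assoc in e; ra; auto. }
  destruct (pullback_lift pbQ (a := x) (b := m ∘ (u1 ∘ k))) as (q & qe1 & qe2).
  { rewrite fx; now ra. }
  destruct (pullback_lift pbQU qe2) as (l & l1 & l2).
  exists l; apply (pullback_jointly_monic pbU).
  - rw pi1; exact l2.
  - rw pi2; rw l1; rw qe1; exact xE. }
destruct (@descend QU UM N pi (yN ∘ s ∘ j1) rpi) as [ev evE].
{ intros K j j' sK jj.
  assert (jj2 : j2 ∘ j = j2 ∘ j') by (rwl pi1; rw jj; rw pi1; reflexivity).
  destruct (lK K (j1 ∘ j) (j1 ∘ j')) as (x & x1 & x2).
  { rw (proj1 pbQU); rw jj2; rwl (proj1 pbQU); reflexivity. }
  { assert (e := f_equal (fun y => u2 ∘ y) jj); cbn in e.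
    rewrite !comp_assoc, pi2, <- !comp_assoc in e; ra; exact e. }
  ra; rewrite <- x1, <- x2.
  assert (e := proj1 (mE U m) (ex_intro _ (idm U) (comp_idr m)) K (j2 ∘ j) x sK).
  rewrite <- !comp_assoc in e; apply e.
  rewrite x1; rw (proj1 pbQU); reflexivity. }
exists U, (z ∘ w ∘ m), UM, u1, u2, ev; split; [exact pbU|split].
{ apply (regular_epi_epi rpi); rw evE; rw eY; rw over; rw pi2; reflexivity. }
intros T t TM q1 q2 phi sT pbT ephi.
destruct (S_projective sT t rz) as [l lt].
destruct (has_pullbacks lim f l) as (Q' & p1' & p2' & pb').
(* Projectivity of the index object over [T] lets [phi] lift to [Y]. *)
assert (pQ := star sX sT sZ pb').
destruct (pullback_lift pbT (a := p2') (b := xM ∘ p1')) as (psi & psi1 & psi2).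
{ rewrite <- lt; rwl (proj1 pb'); rw eX; reflexivity. }
destruct (lY Q' (phi ∘ psi) p1' pQ) as (s' & s1 & s2).
{ rw ephi; rw psi2; reflexivity. }
destruct (univ T l Q' p1' p2' s' sT pb' s2) as (h & k & eh & ek1 & ek2 & es).
(* For the member named by [h], the value at an index is [phi] at its image in [M]; hence [h]
   factors through [U]. *)
assert (claim : forall (K : Ob E) (k0 : Hom K T) (q : Hom K Q), p2 ∘ q = h ∘ k0 ->
  exists i : Hom K TM, q1 ∘ i = k0 /\ q2 ∘ i = xM ∘ (p1 ∘ q) /\
    yN ∘ (s ∘ q) = phi ∘ i).
{ intros K k0 q eq0.
  destruct (pullback_lift pb' (a := p1 ∘ q) (b := k0)) as (q' & qe1 & qe2).
  { rw (proj1 pbQ); rewrite eq0; rw eh; reflexivity. }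
  assert (kq : k ∘ q' = q).
  { apply (pullback_jointly_monic pbQ); [rw ek1; exact qe1|].
    rw ek2; rewrite qe2; auto. }
  exists (psi ∘ q'); split; [rw psi1; exact qe2|split].
  - rw psi2; rw qe1; reflexivity.
  - rewrite <- kq; rw es; rw s1; reflexivity. }
destruct (proj2 (mE T h)) as [h' hE].
{ intros K k0 x sK ex; ra.
  destruct (claim K k0 (k1 ∘ x)) as (i & i1 & i2 & i3); [rewrite <- ex; now ra|].
  destruct (claim K k0 (k2 ∘ x)) as (i' & i1' & i2' & i3').
  { rewrite <- ex; rw e1; reflexivity. }
  rewrite i3, i3'; f_equal; apply (pullback_jointly_monic pbT); [congruence|].
  rewrite i2, i2'.
  assert (e := f_equal (fun y => y ∘ x) e2); cbn in e.
  rewrite <- !comp_assoc in e; exact e. }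
exists h'; split; [rw hE; rw eh; exact lt|].
intros K i j sK ej1 ej2.
destruct (S_projective sK j rpi) as [j' <-].
destruct (claim K (q1 ∘ i) (j1 ∘ j')) as (i' & i1 & i2 & i3).
{ rw (proj1 pbQU); rwl pi1; rewrite ej1; rw hE; reflexivity. }
rw evE; rewrite i3; f_equal; apply (pullback_jointly_monic pbT); [exact i1|].
rewrite i2, <- ej2; rw pi2; reflexivity.
Qed.

(** Members of the weak exponential with the same values are identified. A name of [phi] exists on a
    cover of [T]; in the quotient it becomes unique and descends to [T]. *)
Lemma exponential (A M N : Ob E) (a : Hom M A) (b : Hom N A) :
  exists (U : Ob E) (r : Hom U A) (UM : Ob E) (p1 : Hom UM U) (p2 : Hom UM M)
      (ev : Hom UM N),
    IsPullback r a p1 p2 /\ b ∘ ev = a ∘ p2 /\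
    forall (T : Ob E) (t : Hom T A) (TM : Ob E) (q1 : Hom TM T) (q2 : Hom TM M)
        (phi : Hom TM N),
      IsPullback t a q1 q2 -> b ∘ phi = a ∘ q2 ->
    exists! h : Hom T U, r ∘ h = t /\
      forall (K : Ob E) (i : Hom K TM) (j : Hom K UM), S K ->
        p1 ∘ j = h ∘ (q1 ∘ i) -> p2 ∘ j = q2 ∘ i -> ev ∘ j = phi ∘ i.
Proof.
destruct (weak_exponential a b) as (U & r & UM & p1 & p2 & ev0 & pbU & ov & univ).
destruct (has_pullbacks lim r r) as (UU & d1 & d2 & pbUU).
(* [UUM] consists of two members over the same base and a common argument in [M]; [s1] and [s2] pair
   each member with that argument. *)
destruct (has_pullbacks lim (r ∘ d1) a) as (UUM & e1 & e2 & pbUUM).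
assert (eU := proj1 pbUUM); rewrite <- comp_assoc in eU.
destruct (pullback_lift pbU (a := d1 ∘ e1) (b := e2)) as (s1 & s11 & s12); [exact eU|].
destruct (pullback_lift pbU (a := d2 ∘ e1) (b := e2)) as (s2 & s21 & s22).
{ rwl (proj1 pbUU); exact eU. }
destruct (forall_equal e1 (ev0 ∘ s1) (ev0 ∘ s2)) as (R & m & mm & mE).
assert (rel : forall (T : Ob E) (x y : Hom T U),
  Related (d1 ∘ m) (d2 ∘ m) x y <-> r ∘ x = r ∘ y /\
    forall (K : Ob E) (k : Hom K T) (i j : Hom K UM), S K ->
      p1 ∘ i = x ∘ k -> p1 ∘ j = y ∘ k -> p2 ∘ i = p2 ∘ j -> ev0 ∘ i = ev0 ∘ j).
{ intros T x y; split.
  - intros (c & <- & <-); split; [rw (proj1 pbUU); reflexivity|].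
    intros K k i j sK ei ej ij.
    destruct (pullback_lift pbUUM (a := m ∘ (c ∘ k)) (b := p2 ∘ i)) as (n & n1 & n2).
    { rwl (proj1 pbU); rewrite ei; now ra. }
    replace i with (s1 ∘ n); [replace j with (s2 ∘ n)|].
    + rewrite !comp_assoc.
      apply (proj1 (mE T (m ∘ c)) (ex_intro _ c eq_refl) K k); [auto|].
      rewrite n1; now ra.
    + apply (pullback_jointly_monic pbU); [rw s21; rewrite n1, ej; now ra|].
      rw s22; congruence.
    + apply (pullback_jointly_monic pbU); [rw s11; rewrite n1, ei; now ra|].
      rw s12; congruence.
  - intros [exy ext].
    destruct (pullback_lift pbUU exy) as (c & <- & <-).
    destruct (proj2 (mE T c)) as [c' <-].
    + intros K k n sK en; ra; apply (ext K k); [auto| | |].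
      * rw s11; rw en; reflexivity.
      * rw s21; rw en; reflexivity.
      * rw s12; rw s22; reflexivity.
    + exists c'; split; now ra. }
assert (jm : JointlyMonic (d1 ∘ m) (d2 ∘ m)).
{ intros T x y ex ey; apply mm, (pullback_jointly_monic pbUU); now rewrite !comp_assoc. }
destruct (@quotient R U (d1 ∘ m) (d2 ∘ m) jm) as (Q & q & rq & qE).
{ intros K x sK; apply rel; split; [reflexivity|].
  intros K' k i j sK' ei ej ij.
  f_equal; apply (pullback_jointly_monic pbU); congruence. }
{ intros K x y sK; rewrite !rel; intros [exy ext]; split; [auto|].
  intros K' k i j sK' ei ej ij; symmetry; now apply (ext K' k). }
{ intros K x y w sK; rewrite !rel; intros [exy ext] [eyw ext']; split; [congruence|].
  intros K' k i j sK' ei ej ij.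
  destruct (pullback_lift pbU (a := y ∘ k) (b := p2 ∘ i)) as (n & n1 & n2).
  { rwl (proj1 pbU); rewrite ei, !comp_assoc; now rewrite exy. }
  transitivity (ev0 ∘ n); [apply (ext K' k)|apply (ext' K' k)]; auto; congruence. }
assert (qrel : forall (T : Ob E) (x y : Hom T U), q ∘ x = q ∘ y <->
    r ∘ x = r ∘ y /\
    forall (K : Ob E) (k : Hom K T) (i j : Hom K UM), S K ->
      p1 ∘ i = x ∘ k -> p1 ∘ j = y ∘ k -> p2 ∘ i = p2 ∘ j -> ev0 ∘ i = ev0 ∘ j).
{ intros T x y; rewrite qE; apply rel. }
clear mE rel jm qE.
destruct (@descend U Q A q r rq) as [rQ rqE].
{ intros K j j' sK jj; now apply qrel in jj. }
destruct (has_pullbacks lim rQ a) as (QM & c1 & c2 & pbQ).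
destruct (pullback_lift pbQ (a := q ∘ p1) (b := p2)) as (mu & mu1 & mu2).
{ rw rqE; exact (proj1 pbU). }
assert (rmu : IsRegularEpi mu).
{ apply regular_epi_on_points; intros K k sK.
  destruct (S_projective sK (c1 ∘ k) rq) as [u ue].
  destruct (pullback_lift pbU (a := u) (b := c2 ∘ k)) as (n & n1 & n2).
  { rwl (proj1 pbQ); rwl ue; rw rqE; reflexivity. }
  exists n; apply (pullback_jointly_monic pbQ); [rw mu1; now rewrite n1|].
  rw mu2; exact n2. }
destruct (@descend UM QM N mu ev0 rmu) as [ev evE].
{ intros K j j' sK jj.
  assert (qq : q ∘ (p1 ∘ j) = q ∘ (p1 ∘ j')) by (rwl mu1; rw jj; rw mu1; reflexivity).
  apply (proj2 (proj1 (qrel _ _ _) qq) K (idm K)); [auto| | |]; rewrite ?comp_idr; auto.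
  rwl mu2; rw jj; rw mu2; reflexivity. }
exists Q, rQ, QM, c1, c2, ev; split; [exact pbQ|split].
{ apply (regular_epi_epi rmu); rw evE; rw mu2; exact ov. }
intros T t TM q1 q2 phi pbT ephi.
(* Two names of [phi] over the same [k] become equal in [Q]; the disjunction states the evaluation
   condition for both at once. *)
assert (uniq : forall (K : Ob E) (k : Hom K T) (x y : Hom K U),
  r ∘ x = t ∘ k -> r ∘ y = t ∘ k ->
  (forall (L : Ob E) (l : Hom L K) (i : Hom L TM) (j : Hom L UM), S L ->
     q1 ∘ i = k ∘ l -> p2 ∘ j = q2 ∘ i -> p1 ∘ j = x ∘ l \/ p1 ∘ j = y ∘ l ->
     ev0 ∘ j = phi ∘ i) -> q ∘ x = q ∘ y).
{ intros K k x y ex ey H; apply qrel; split; [congruence|].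
  intros L l i j sL ei ej ij.
  destruct (pullback_lift pbT (a := k ∘ l) (b := p2 ∘ i)) as (n & n1 & n2).
  { rwl (proj1 pbU); rewrite ei, !comp_assoc; now rewrite ex. }
  transitivity (phi ∘ n); [|symmetry]; apply (H L l); auto; congruence. }
destruct (cover T) as (T' & c & sT & rc).
destruct (has_pullbacks lim (t ∘ c) a) as (T'M & q1' & q2' & pbT').
destruct (pullback_lift pbT (a := c ∘ q1') (b := q2')) as (chi & chi1 & chi2).
{ rewrite comp_assoc; exact (proj1 pbT'). }
destruct (univ T' (t ∘ c) T'M q1' q2' (phi ∘ chi) sT pbT') as (h & hE & hev).
{ rw ephi; rw chi2; reflexivity. }
assert (key : forall (K : Ob E) (k : Hom K T') (i : Hom K TM) (j : Hom K UM), S K ->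
  p1 ∘ j = h ∘ k -> q1 ∘ i = c ∘ k -> p2 ∘ j = q2 ∘ i -> ev0 ∘ j = phi ∘ i).
{ intros K k i j sK ej ei ij.
  destruct (pullback_lift pbT' (a := k) (b := q2 ∘ i)) as (n & n1 & n2).
  { rwl (proj1 pbT); rw ei; reflexivity. }
  replace i with (chi ∘ n).
  - rewrite (hev K n j sK); [now ra|now rewrite n1|now rewrite n2].
  - apply (pullback_jointly_monic pbT); [rw chi1; now rewrite n1|].
    rw chi2; exact n2. }
(* Points of [T'] with the same image in [T] yield names of the same map. *)
destruct (@descend T' T Q c (q ∘ h) rc) as [g gE].
{ intros K j j' sK jj; ra; apply (uniq K (c ∘ j)).
  - rw hE; reflexivity.
  - rw hE; now rewrite jj.
  - intros L l i n sL ei ni [en|en].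
    + rewrite <- comp_assoc in en, ei; now apply (key L (j ∘ l)).
    + rewrite jj in ei; rewrite <- comp_assoc in en, ei; now apply (key L (j' ∘ l)). }
assert (rg : rQ ∘ g = t).
{ apply (regular_epi_epi rc); rw gE; rw rqE; exact hE. }
assert (evg : forall (K : Ob E) (i : Hom K TM) (j : Hom K QM), S K ->
  c1 ∘ j = g ∘ (q1 ∘ i) -> c2 ∘ j = q2 ∘ i -> ev ∘ j = phi ∘ i).
{ intros K i j sK ej1 ej2.
  destruct (S_projective sK (q1 ∘ i) rc) as [k kE].
  destruct (pullback_lift pbU (a := h ∘ k) (b := q2 ∘ i)) as (n & n1 & n2).
  { rw hE; rw kE; rw (proj1 pbT); reflexivity. }
  replace j with (mu ∘ n); [rw evE; now apply (key K k)|].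
  apply (pullback_jointly_monic pbQ).
  - rw mu1; rewrite n1; rwl gE; rw kE; auto.
  - rw mu2; congruence. }
exists g; split; [now split|].
(* On points both maps lift along [q] to names of [phi], to which [uniq] applies. *)
intros g' [rg' evg']; apply eq_on_points; intros K k sK.
destruct (S_projective sK (g ∘ k) rq) as [x xE].
destruct (S_projective sK (g' ∘ k) rq) as [y yE].
rewrite <- xE, <- yE; apply (uniq K k).
- rwl rqE; rw xE; rw rg; reflexivity.
- rwl rqE; rw yE; rw rg'; reflexivity.
- intros L l i j sL ei ij [ej|ej]; rewrite <- evE; ra; [apply evg|apply evg']; auto.
  + rw mu1; rw ej; rw xE; now rewrite ei.
  + rw mu2; exact ij.
  + rw mu1; rw ej; rw yE; now rewrite ei.
  + rw mu2; exact ij.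
Qed.

(** The condition on [i] and [j] in [exponential] says, on points, that [ev] after [g × id] is
    [phi]. *)
Lemma locally_cartesian_closed : IsLocallyCartesianClosed E.
Proof.
intros A; split; [|split].
- exists {| slice_dom := A; slice_map := idm A |}; intros x.
  exists (@slice_hom A x {| slice_dom := A; slice_map := idm A |} (slice_map x)
    (comp_idl _)); split; [trivial|].
  intros [v vE] _; apply SliceHom_eq; cbn in *; now rewrite comp_idl in vE.
- intros x y.
  destruct (has_pullbacks lim (slice_map x) (slice_map y)) as (V & p1 & p2 & pb).
  pose (z := {| slice_dom := V; slice_map := slice_map x ∘ p1 |} : Ob (Slice A)).
  exists z, (@slice_hom A z x p1 eq_refl), (@slice_hom A z y p2 (eq_sym (proj1 pb))).
  now apply slice_product.
- intros [M a] [N b].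
  destruct (exponential a b) as (U & r & UM & p1 & p2 & ev & pb & eev & univ).
  pose (X := {| slice_dom := U; slice_map := r |} : Ob (Slice A)).
  pose (XA := {| slice_dom := UM; slice_map := r ∘ p1 |} : Ob (Slice A)).
  pose (M' := {| slice_dom := M; slice_map := a |} : Ob (Slice A)).
  pose (N' := {| slice_dom := N; slice_map := b |} : Ob (Slice A)).
  assert (eev' : b ∘ ev = r ∘ p1) by (rewrite eev; exact (eq_sym (proj1 pb))).
  exists X, XA, (@slice_hom A XA X p1 eq_refl),
    (@slice_hom A XA M' p2 (eq_sym (proj1 pb))), (@slice_hom A XA N' ev eev').
  split; [now apply slice_product|].
  intros [T t] [TM tm] [q1 q1E] [q2 q2E] [phi phiE] prod.
  apply slice_product in prod; cbn in *.
  destruct (univ T t TM q1 q2 phi prod) as (g & [rg evg] & gq); [congruence|].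
  destruct (pullback_lift pb (a := g ∘ q1) (b := q2)) as (m & m1 & m2).
  { rw rg; exact (proj1 prod). }
  assert (mE : r ∘ p1 ∘ m = tm) by (rw m1; rw rg; exact q1E).
  exists (exist _ g rg); split.
  + exists (exist _ m mE); split; [split|]; apply SliceHom_eq; cbn; auto.
    apply eq_on_points; intros K k sK; ra; apply evg; [auto| |].
    * rw m1; reflexivity.
    * rw m2; reflexivity.
  + intros [g' rg'] ([m' mE'] & [m1' m2'] & em'); apply SliceHom_eq, gq; cbn in *.
    apply (f_equal (@proj1_sig _ _)) in m1', m2', em'; cbn in *.
    split; [auto|]; intros K i j sK j1 j2.
    replace j with (m' ∘ i); [now rw em'|].
    apply (pullback_jointly_monic pb); [rw m1'|rw m2']; auto.
Qed.

End GenericSections.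

(** * From exponentials to extensional dependent products *)

Lemma slice_exponential (A M N : Ob E) (a : Hom M A) (b : Hom N A) :
  IsLocallyCartesianClosed E ->
  exists (U : Ob E) (r : Hom U A) (UM : Ob E) (p1 : Hom UM U) (p2 : Hom UM M)
      (ev : Hom UM N),
    IsPullback r a p1 p2 /\ b ∘ ev = a ∘ p2 /\
    forall (T : Ob E) (t : Hom T A) (TM : Ob E) (q1 : Hom TM T) (q2 : Hom TM M)
        (phi : Hom TM N),
      IsPullback t a q1 q2 -> b ∘ phi = a ∘ q2 ->
    exists! h : Hom T U, r ∘ h = t /\
      exists m : Hom TM UM, p1 ∘ m = h ∘ q1 /\ p2 ∘ m = q2 /\ ev ∘ m = phi.
Proof.
intros lcc.
pose (M' := {| slice_dom := M; slice_map := a |} : Ob (Slice A)).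
pose (N' := {| slice_dom := N; slice_map := b |} : Ob (Slice A)).
destruct (proj2 (proj2 (lcc A)) M' N')
  as ([U r] & [UM um] & [p1 p1E] & [p2 p2E] & [ev evE] & prod & univ).
apply slice_product in prod; cbn in *.
exists U, r, UM, p1, p2, ev; split; [exact prod|split; [congruence|]].
intros T t TM q1 q2 phi pb ephi.
pose (T' := {| slice_dom := T; slice_map := t |} : Ob (Slice A)).
pose (TM' := {| slice_dom := TM; slice_map := t ∘ q1 |} : Ob (Slice A)).
assert (phiE : b ∘ phi = t ∘ q1) by (rewrite ephi; exact (eq_sym (proj1 pb))).
destruct (univ T' TM' (@slice_hom A TM' T' q1 eq_refl)
  (@slice_hom A TM' M' q2 (eq_sym (proj1 pb))) (@slice_hom A TM' N' phi phiE))
  as ([g gE] & ([m mE] & [m1 m2] & em) & gq); [now apply slice_product|].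
apply (f_equal (@proj1_sig _ _)) in m1, m2, em; cbn in *.
exists g; split; [split; [auto|now exists m]|].
intros g' (g'E & m' & m1' & m2' & em').
assert (m'E : r ∘ p1 ∘ m' = t ∘ q1) by (rw m1'; rw g'E; reflexivity).
assert (m'E' : um ∘ m' = t ∘ q1) by now rewrite <- p1E.
specialize (gq (exist _ g' g'E)); apply (f_equal (@proj1_sig _ _)) in gq; [exact gq|].
exists (exist _ m' m'E'); split; [split|]; apply SliceHom_eq; cbn; auto.
Qed.

(* The sections of [g] form the equaliser of two maps from the exponential
   [Y^X] to [X^X] over [Z]: postcomposition with [g], and the constant map at
   the identity. *)
Lemma locally_cartesian_closed_generic_section (Y X Z : Ob E)
    (g : Hom Y X) (f : Hom X Z) : IsLocallyCartesianClosed E ->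
  HasGenericSection (fun _ => True) g f.
Proof.
intros lcc.
destruct (slice_exponential f (f ∘ g) lcc)
  as (U & r & UX & p1 & p2 & ev & pbU & eev & univU).
destruct (slice_exponential f f lcc)
  as (F & rF & FX & f1 & f2 & evF & pbF & eevF & univF).
destruct (univF U r UX p1 p2 (g ∘ ev) pbU) as (G & (GE & m & m1 & m2 & em) & _).
{ now rewrite comp_assoc. }
destruct (univF U r UX p1 p2 p2 pbU) as (G' & (GE' & m' & m1' & m2' & em') & _); [auto|].
destruct (has_equalizers lim G G') as (W & d & _ & ed & ld).
destruct (has_pullbacks lim f (r ∘ d)) as (Q & q1 & q2 & pbQ).
destruct (pullback_lift pbU (a := d ∘ q2) (b := q1)) as (n & n1 & n2).
{ rewrite comp_assoc; exact (eq_sym (proj1 pbQ)). }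
exists W, (r ∘ d), Q, q1, q2, (ev ∘ n); split; [trivial|split; [auto|split]].
- rwl em; rewrite <- n2; rwl em'; f_equal.
  apply (pullback_jointly_monic pbF).
  + rw m1; rw m1'; rewrite n1; rw ed; reflexivity.
  + rw m2; rw m2'; reflexivity.
- intros W' w' Q' p1' p2' s' _ pb' over.
  assert (pb'' : IsPullback w' f p2' p1').
  { apply pullback_of_lift; [exact (eq_sym (proj1 pb'))| |].
    - intros T x y ex ey; now apply (pullback_jointly_monic pb').
    - intros T x y exy; destruct (pullback_lift pb' (eq_sym exy)) as (z & z1 & z2).
      now exists z. }
  destruct (univU W' w' Q' p2' p1' s' pb'') as (h0 & (h0E & k0 & k1 & k2 & ek) & _).
  { rw over; reflexivity. }
  destruct (univF W' w' Q' p2' p1' p1' pb'') as (l & _ & lq); [auto|].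
  (* Both [G ∘ h0] and [G' ∘ h0] name [p1'], so uniqueness makes [h0] factor through the
     equaliser. *)
  destruct (ld W' h0) as [h hE].
  { rewrite <- (lq (G ∘ h0)), <- (lq (G' ∘ h0)); [auto| |].
    - split; [rw GE'; exact h0E|]; exists (m' ∘ k0); split; [|split].
      + rw m1'; now rewrite k1.
      + rw m2'; exact k2.
      + rw em'; exact k2.
    - split; [rw GE; exact h0E|]; exists (m ∘ k0); split; [|split].
      + rw m1; now rewrite k1.
      + rw m2; exact k2.
      + rw em; now rewrite ek. }
  destruct (pullback_lift pbQ (a := p1') (b := h ∘ p2')) as (k & kE1 & kE2).
  { rw hE; rw h0E; exact (proj1 pb'). }
  exists h, k; split; [rw hE; exact h0E|split; [auto|split; [auto|]]].
  rewrite <- ek; ra; f_equal; apply (pullback_jointly_monic pbU).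
  + rw n1; rw kE2; rw hE; now rewrite k1.
  + rw n2; congruence.
Qed.

(* An extensional dependent product of [g] along [f] covers the dependent
   product of the map induced by [g] on the quotient of [Y]; the object [V] is
   a cover of the pullback of evaluation against [Y -> Y/~], rather than of the
   mere fibre product [X ×_Z W], so that the comparison maps strictly
   commute with [e]. *)
Lemma extensional_dependent_products :
  (forall (Y X Z : Ob E) (g : Hom Y X) (f : Hom X Z),
     HasGenericSection (fun _ => True) g f) ->
  HasExtensionalDependentProducts (FullSub S).
Proof.
intros generic [Y sY] [X sX] [Z sZ] [Yb sYb] g f y1 y2.
intros (rho & sigma & [WW sWW] & t1 & t2 & tau & wpb
  & rho1 & rho2 & si1 & si2 & tau1 & tau2) gy.
apply IsWeakPullback_FullSub in wpb; destruct wpb as [_ trans]; cbn in *.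
destruct (has_products lim Y Y) as (YY & pi1 & pi2 & prod).
destruct (prod Yb y1 y2) as (y & [ye1 ye2] & _).
(* The image of the pairing of [y1], [y2] is jointly monic and relates the same points. *)
destruct (image y) as (R & e & m & re & mm & me).
assert (rel : forall (K : Ob E) (a b : Hom K Y), S K ->
  Related (pi1 ∘ m) (pi2 ∘ m) a b <-> Related y1 y2 a b).
{ intros K a b sK; split; intros (c & <- & <-).
  - destruct (S_projective sK c re) as [c' <-]; exists c'.
    rewrite <- ye1, <- ye2, <- me; split; now ra.
  - exists (e ∘ c); rewrite <- ye1, <- ye2, <- me; split; now ra. }
destruct (@quotient R Y (pi1 ∘ m) (pi2 ∘ m)) as (B & q & rq & qE).
{ intros T a b ea eb; apply mm.
  destruct (prod _ (pi1 ∘ m ∘ a) (pi2 ∘ m ∘ a)) as (z & _ & zq).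
  rewrite <- (zq (m ∘ a)), <- (zq (m ∘ b)); auto; split; now rewrite comp_assoc. }
{ intros K a sK; apply rel; [auto|]; exists (rho ∘ a); split.
  - rw rho1; reflexivity.
  - rw rho2; reflexivity. }
{ intros K a b sK; rewrite !rel; auto; intros (c & <- & <-).
  exists (sigma ∘ c); split; [rw si1|rw si2]; reflexivity. }
{ intros K a b d sK; rewrite !rel; auto; intros (c & <- & cb) (c' & c'b & <-).
  destruct (trans K c c' sK) as (n & <- & <-); [congruence|].
  exists (tau ∘ n); split; [rw tau1|rw tau2]; reflexivity. }
assert (qrel : forall (K : Ob E) (a b : Hom K Y), S K ->
  q ∘ a = q ∘ b <-> Related y1 y2 a b).
{ intros K a b sK; rewrite qE; now apply rel. }
clear rel qE.
destruct (@descend Y B X q g rq) as [g' gE].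
{ intros K j j' sK jj; apply qrel in jj; [|auto]; destruct jj as (c & <- & <-).
  rw gy; reflexivity. }
destruct (generic B X Z g' f) as (P & pi & QP & u1 & u2 & s & _ & pbP & over & univ).
destruct (cover P) as (W & c & sW & rc).
destruct (has_pullbacks lim f (pi ∘ c)) as (Q & a1 & a2 & pbQ).
destruct (pullback_lift pbP (a := a1) (b := c ∘ a2)) as (th & th1 & th2).
{ rewrite comp_assoc; exact (proj1 pbQ). }
destruct (pullback_cover (s ∘ th) q) as (V & v & ev & sV & eV & lV).
unshelve eexists (@Build_DepProdData (FullSub S)
  (exist _ Y sY) (exist _ X sX) (exist _ Z sZ) (exist _ Yb sYb) g f y1 y2
  (exist _ W sW) (pi ∘ c) (exist _ V sV) (a1 ∘ v) (a2 ∘ v) ev _ _ _).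
- apply IsWeakPullback_FullSub; cbn; split; [rw (proj1 pbQ); reflexivity|].
  intros K a b sK eab; destruct (pullback_lift pbQ eab) as (k & <- & <-).
  destruct (S_projective sK (s ∘ th ∘ k) rq) as [x xE].
  destruct (lV K k x (S_projective sK) (eq_sym xE)) as (n & <- & _).
  exists n; split; now ra.
- apply preserves_projections_on_points; cbn; intros K a b sK ea eb.
  apply qrel; [auto|]; rwl eV; rwl eV; do 2 f_equal.
  apply (pullback_jointly_monic pbQ); now rewrite !comp_assoc.
- cbn; rewrite <- gE; rwl eV; rw over; rw th1; reflexivity.
- intros [[W' sW'] w' [V' sV'] p1' p2' e' wpb pres over']; cbn in *.
  apply IsWeakPullback_FullSub in wpb; destruct wpb as [ew lw]; cbn in *.
  assert (pres' := proj1 (preserves_projections_on_points _ _ _ _ _) pres); cbn in pres'.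
  destruct (has_pullbacks lim f w') as (Q' & b1 & b2 & pb').
  destruct (pullback_lift pb' ew) as (c' & <- & <-).
  assert (rc' := weak_pullback_regular_epi pb' lw).
  (* Preservation of projections makes [q ∘ e'] constant on the fibres of [c'], hence a map on the
     pullback. *)
  destruct (@descend V' Q' B c' (q ∘ e') rc') as [s' sE].
  { intros K j j' sK jj; ra; apply qrel, pres'; auto; rw jj; reflexivity. }
  destruct (univ W' w' Q' b1 b2 s' I pb') as (h0 & k0 & h0E & k01 & k02 & sk).
  { apply (regular_epi_epi rc'); rw sE; rw gE; exact over'. }
  (* Projectivity of [W'] lifts the map into the dependent product [P] to its cover [W]. *)
  destruct (S_projective sW' h0 rc) as [h hE].
  destruct (pullback_lift pbQ (a := b1 ∘ c') (b := h ∘ (b2 ∘ c'))) as (k1 & k11 & k12).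
  { rw hE; rw h0E; rw (proj1 pb'); reflexivity. }
  destruct (lV V' k1 e' (S_projective sV')) as (k & vk & ek).
  { rewrite <- sE, <- sk; ra; f_equal; apply (pullback_jointly_monic pbP).
    - rw th1; rw k01; exact k11.
    - rw th2; rw k02; rewrite k12; rw hE; reflexivity. }
  exists h, k; split; [|split; [|split]].
  + rw hE; exact h0E.
  + rw vk; exact k11.
  + rw vk; exact k12.
  + exact ek.
Qed.

End Cover.

(** The pair of identities is a pseudo equivalence relation whose structure maps are all
    identities. *)
Lemma extensional_weak_dependent_products (C : Category) :
  HasExtensionalDependentProducts C -> HasWeakDependentProducts C.
Proof.
intros ext Y X Z g f; apply ext; [|reflexivity].
exists (idm Y), (idm Y), Y, (idm Y), (idm Y), (idm Y).
repeat split; rewrite ?comp_idl; auto.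
intros T a b; rewrite !comp_idl; intros ->; exists b; now rewrite comp_idl.
Qed.

Theorem corollary4p18 (E : Category) (S : Ob E -> Prop) :
  IsExact E -> IsProjectiveCover S ->
  let C := FullSub S in
  let cond_a := SliceProjectivesInternallyProjective S in
  let cond_b := ProjectivesHavePullbacks E in
  let cond_c := WeakPullbacksHaveIdempotents C in
  ((cond_a <-> cond_b) /\ (cond_b <-> cond_c)) /\
  (cond_a \/ cond_b \/ cond_c ->
     (HasWeakDependentProducts C <-> HasExtensionalDependentProducts C) /\
     (HasExtensionalDependentProducts C <-> IsLocallyCartesianClosed E)).
Proof.
intros exactE cov C cond_a cond_b cond_c.
assert (starA : PullbacksProjective S <-> cond_a)
  by exact (pullbacks_projective_slices exactE cov).
assert (starB : PullbacksProjective S <-> cond_b)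
  by exact (pullbacks_projective_projectives_have_pullbacks exactE cov).
assert (starC : PullbacksProjective S <-> cond_c)
  by exact (pullbacks_projective_idempotents exactE cov).
split; [tauto|]; intros cond.
assert (star : PullbacksProjective S) by tauto.
(* The implications close a cycle: weak dependent products, local cartesian closure, extensional
   dependent products, weak ones again. *)
assert (ext_weak := @extensional_weak_dependent_products C).
assert (weak_lcc : HasWeakDependentProducts C -> IsLocallyCartesianClosed E).
{ intros wdp; apply (locally_cartesian_closed exactE cov star).
  intros Y X Z g f; now apply weak_dependent_product_generic_section. }
assert (lcc_ext : IsLocallyCartesianClosed E -> HasExtensionalDependentProducts C).
{ intros lcc; apply (extensional_dependent_products exactE cov).
  intros Y X Z g f; now apply locally_cartesian_closed_generic_section. }
tauto.
Qed.
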